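(* Let $X$ be a Banach space with dual $X^*$. Suppose $X^*=\overline{\mathrm{span}}^{|||\cdot|||}(K)$, where $K\subseteq X^*$ is a Gruenhage compact space in the $w^*$-topology and $|||\cdot|||$ is a norm on $X^*$ that is equivalent to a coarser, $w^*$-lower semicontinuous norm on $X^*$. Then $X^*$ admits an equivalent, strictly convex dual norm.
   Context: All Banach spaces are real. A topological space $T$ is a Gruenhage space if there exist families $(\mathscr{U}_n)_{n\in\mathbb{N}}$ of open subsets of $T$ such that for any distinct $x,y\in T$ there exist $n\in\mathbb{N}$ and $U\in\mathscr{U}_n$ with: (i) $U\cap\{x,y\}$ is a singleton; (ii) either $x$ lies in only finitely many $U'\in\mathscr{U}_n$ or $y$ lies in only finitely many $U'\in\mathscr{U}_n$. A Gruenhage compact is a compact Hausdorff Gruenhage space. A norm $|||\cdot|||$ on $X^*$ is coarser than the original dual norm $\|\cdot\|$ if there is a constant $C$ with $|||f|||\le C\|f\|$ for all $f\in X^*$. $\overline{\mathrm{span}}^{|||\cdot|||}(K)$ is the closure of the linear span of $K$ in the norm $|||\cdot|||$. A norm is strictly convex if $\|x\|=\|y\|=\frac12\|x+y\|$ implies $x=y$. An equivalent dual norm on $X^*$ is the dual norm of an equivalent norm on $X$ (equivalently, an equivalent $w^*$-lower semicontinuous norm). *)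

(* Defs.v *)
From HB Require Import structures.
From mathcomp Require Import all_boot all_order all_algebra.
From mathcomp Require Import all_classical all_reals all_analysis.

Set Implicit Arguments.
Unset Strict Implicit.
Unset Printing Implicit Defensive.

Import Order.TTheory GRing.Theory Num.Theory.
Import numFieldNormedType.Exports.

Local Open Scope classical_set_scope.
Local Open Scope ring_scope.

Definition gruenhage_space (T : topologicalType) : Prop :=
  exists U_ : nat -> set (set T),
    (forall n V, U_ n V -> open V) /\
    forall x y : T, x <> y -> exists n V,
      [/\ U_ n V,
          (exists z, V `&` [set x; y] = [set z]) &
          finite_set [set V' | U_ n V' /\ V' x] \/
          finite_set [set V' | U_ n V' /\ V' y]].

Definition gruenhage_compact (T : topologicalType) : Prop :=
  [/\ compact [set: T], hausdorff_space T & gruenhage_space T].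

Section norms.
Context {R : realType} {V : lmodType R}.
Implicit Types (p q : V -> R) (A : set V).

(* The fields are those of the factory [Lmodule_isNormed]; nonnegativity
   follows from them. *)
Record is_norm p : Prop := IsNorm {
  is_normD : forall x y, p (x + y) <= p x + p y ;
  is_normZ : forall (a : R) x, p (a *: x) = `|a| * p x ;
  is_norm0_eq0 : forall x, p x = 0 -> x = 0 }.

Definition norm_coarser p q : Prop := exists C : R, forall x, p x <= C * q x.

Definition norm_equivalent p q : Prop := norm_coarser p q /\ norm_coarser q p.

Definition strictly_convex p : Prop :=
  forall x y, p x = p y -> p y = 2^-1 * p (x + y) -> x = y.

Definition linear_span A : set V :=
  [set x | exists (n : nat) (a : 'I_n -> R) (v : 'I_n -> V),
    (forall i, A (v i)) /\ x = \sum_(i < n) a i *: v i].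

Definition norm_closure p A : set V :=
  [set x | forall e : R, 0 < e -> exists2 y, A y & p (x - y) < e].

End norms.

Definition continuous_linear {R : realType} (X : normedModType R) :
  {pred X -> R^o} := fun f : X -> R^o => `[< linear f /\ continuous f >].

Record dual {R : realType} (X : normedModType R) := Dual {
  dual_fun :> X -> R^o ;
  dual_subproof : dual_fun \in @continuous_linear R X }.

Section dual_lmodule.
Context {R : realType} {X : normedModType R}.

HB.instance Definition _ := [isSub for @dual_fun R X].
HB.instance Definition _ := [Choice of dual X by <:].

Lemma continuous_linear_submod_closed : submod_closed (@continuous_linear R X).
Proof.
split.
  apply/asboolP; split; last by move=> x; exact: cst_continuous.
  by move=> a x y; change (0 = a *: 0 + 0 :> R^o); rewrite scaler0 addr0.
move=> a f g /asboolP[lf cf] /asboolP[lg cg]; apply/asboolP; split.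
  move=> b x y; change (a *: f (b *: x + y) + g (b *: x + y) =
    b *: (a *: f x + g x) + (a *: f y + g y)).
  rewrite lf lg !scalerDr !scalerA.
  by rewrite (mulrC a b) addrACA.
move=> x; apply: (@cvgD R R^o X (nbhs x) _ (a \*: f) g (a *: f x) (g x)).
  by apply: cvgZl_tmp; exact: cf.
exact: cg.
Qed.

HB.instance Definition _ := GRing.isSubmodClosed.Build R (X -> R^o)
  (@continuous_linear R X) continuous_linear_submod_closed.
HB.instance Definition _ := [SubChoice_isSubLmodule of dual X by <:].

Lemma dual_linear (f : dual X) : linear f.
Proof. by case: f => f /= /asboolP[]. Qed.

Lemma dual_continuous (f : dual X) : continuous f.
Proof. by case: f => f /= /asboolP[]. Qed.

HB.instance Definition _ (f : dual X) :=
  GRing.isLinear.Build R X R^o *:%R (dual_fun f) (dual_linear f).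

End dual_lmodule.

(* The dual norm of a norm [p] on [X].  It is a genuine supremum as soon as
   [p] dominates a multiple of the original norm; [sup] is 0 otherwise. *)
Definition dual_norm {R : realType} {X : normedModType R} (p : X -> R)
    (f : dual X) : R :=
  sup [set `|f x| | x in [set x : X | p x <= 1]].

Section dual_normed.
Context {R : realType} {X : normedModType R}.
Implicit Types f g : dual X.
Let N : dual X -> R := dual_norm (fun x : X => `|x|).

Let has_sup_dual f :
  has_sup [set `|f x| | x in [set x : X | `|x| <= 1]].
Proof.
split; first by exists `|f 0|, 0 => //=; rewrite normr0.
have /linear_boundedP/pinfty_ex_gt0[M M0 fM] :=
  continuous_linear_bounded 0 (@dual_continuous _ _ f 0).
exists M => _ [x /= x1 <-]; apply: le_trans (fM x) _.
by rewrite ler_piMr // ltW.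
Qed.

Let N_ub f x : `|x| <= 1 -> `|f x| <= N f.
Proof.
move=> x1; have [_ ubf] := has_sup_dual f.
by apply: ub_le_sup => //; exists x.
Qed.

Let N_lub f c : (forall x, `|x| <= 1 -> `|f x| <= c) -> N f <= c.
Proof.
move=> fc; have [nef _] := has_sup_dual f.
by apply: ge_sup => // _ [x /= x1 <-]; exact: fc.
Qed.

Let N_ge0 f : 0 <= N f.
Proof. by apply: le_trans (N_ub (x := 0) f _); rewrite ?normr0. Qed.

Let ler_N_D f g : N (f + g) <= N f + N g.
Proof.
apply: N_lub => x x1; apply: le_trans (ler_normD (f x) (g x)) _.
by rewrite lerD // N_ub.
Qed.

Let N_Z_le (a : R) f : N (a *: f) <= `|a| * N f.
Proof.
by apply: N_lub => x x1; rewrite [X in X <= _]normrM ler_wpM2l // N_ub.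
Qed.

Let N_Z (a : R) f : N (a *: f) = `|a| * N f.
Proof.
apply/eqP; rewrite eq_le N_Z_le /=.
have [->|a0] := eqVneq a 0; first by rewrite normr0 mul0r N_ge0.
rewrite -ler_pdivlMl ?normr_gt0 //.
have := N_Z_le a^-1 (a *: f).
by rewrite scalerA mulVf // scale1r normfV.
Qed.

Let N_eq0 f : N f = 0 -> f = 0.
Proof.
move=> Nf0; apply/val_inj/funext => x.
have [->|x0] := eqVneq x 0; first exact: (linear0 f).
have nx0 : `|x| != 0 by rewrite normr_eq0.
have : `|f (`|x|^-1 *: x)| <= N f.
  by apply: N_ub; rewrite normrZ normfV normr_id mulVf.
rewrite Nf0 normr_le0 linearZ /= scaler_eq0 invr_eq0 (negbTE nx0) /=.
by move/eqP.
Qed.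

HB.instance Definition _ := Lmodule_isNormed.Build R (dual X) ler_N_D N_Z N_eq0.

Lemma dual_normE f : `|f| = dual_norm (fun x : X => `|x|) f.
Proof. by []. Qed.

End dual_normed.

(* [dual X] itself carries the topology of the dual norm; [weak_star X] is the
   same set of functionals with the topology of pointwise convergence on [X]. *)
Definition weak_star {R : realType} (X : normedModType R) : topologicalType :=
  initial_topology (fun f : dual X => (f : X -> R^o) : {ptws X -> R^o}).

Definition weak_star_lsc {R : realType} {X : normedModType R}
    (p : dual X -> R) : Prop :=
  lower_semicontinuous (fun f : weak_star X => (p f)%:E).

Definition equivalent_dual_norm {R : realType} {X : normedModType R}
    (q : dual X -> R) : Prop :=
  exists p : X -> R,
    [/\ is_norm p, norm_equivalent p (fun x : X => `|x|) & q = dual_norm p].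

(* Main.v *)
(* Evaluation on the Gruenhage compact T = K gives a map X -> C(T) whose adjoint
   S : C(T)^* -> X^* satisfies S(delta_k) = k, so its range is dense for the coarser
   w*-lower semicontinuous norm M.

   The Gruenhage property yields countably many delta-systems (A_i, S_i) of open
   sets (distinct members of A_i meet inside S_i) whose cells A \ S_i separate the
   points of T.  For each of them, and for their finite products, the seminorms
   mu |-> sup {|mu|(S u A_1 u ... u A_k)} are w*-lower semicontinuous.  If all of
   them, and the total variation, take the same value at mu, nu and (mu + nu) / 2,
   then |mu| and |nu| agree on all cells, since top-k sums determine the masses; by
   a Lusin-type argument they agree on open sets; and then mu = nu, because
   |mu + nu| = |mu| + |nu| forces equal densities.

   Let E be the weighted sum of the squares of these seminorms.  The infimum over
   mu of M(f - S mu)^2 + E(mu) / (k + 1) is attained, is 2-homogeneous, convex and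
   w*-lower semicontinuous in f, and tends to 0 with k.  The sum of |f|^2 and of
   these functions with weights 2^-(k+1) is the square of the required norm: equality in
   the convexity inequality makes the minimisers for f and g have the same image
   under S, so M(f - g) = 0.  A norm equivalent to the dual norm whose unit ball is
   w*-closed is a dual norm by the bipolar theorem. *)
Require Import Defs.
From HB Require Import structures.
From mathcomp Require Import all_boot all_order all_algebra.
From mathcomp Require Import all_classical all_reals all_analysis.
From mathcomp Require Import ring lra.
Import Order.TTheory GRing.Theory Num.Theory.
Import numFieldNormedType.Exports.
Local Open Scope classical_set_scope.
Local Open Scope ring_scope.

Set Implicit Arguments.
Unset Strict Implicit.
Unset Printing Implicit Defensive.


(** * Variation of functionals on C(T) *)

(** A delta-system may be uncountable, so the masses of its cells cannot enter the norm one by one.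
    Taking the supremum over all choices of [k] members leaves one seminorm for each system and each
    [k]. The kernel is added to the chosen members because a cell is not open: the variation of an
    open set is a supremum of evaluations at test functions, hence lower semicontinuous, while the
    mass of a cell is not. Finite products of systems are included because equal masses on the cells
    of single systems say nothing about their intersections. Functionals on [C(T)] are not
    represented by measures. [variation] is a supremum over test functions, and Caratheodory's
    condition for [outer] supplies the additivity on cells. Since the range of the adjoint is only
    dense, and only for [M], no functional need reproduce [f] exactly; hence a sequence of weaker
    and weaker penalties instead of one infimum. *)

Lemma compact_finite_cover (T : topologicalType) (A : set T) (I : eqType)
    (D : set I) (f : I -> set T) :
  compact A -> (forall i, D i -> open (f i)) ->
  (forall x, A x -> exists2 i, D i & f i x) ->
  exists s : seq I, (forall i, i \in s -> D i) /\
    forall x, A x -> exists2 i, i \in s & f i x.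
Proof.
move=> cA fo cov; apply: contrapT => ncov.
pose P (s : seq I) := forall i, i \in s -> D i.
pose B (s : seq I) := A `&` [set x | forall i, i \in s -> ~ f i x].
(* [B s] is what the subfamily [s] leaves uncovered. A cluster point of these sets lies in some
   [f i], which [B [:: i]] does not meet. *)
pose F := filter_from [set s | P s] B.
have FF : ProperFilter F.
  apply: filter_from_proper; last first.
    move=> s Ps; apply: contrapT => nB; apply: ncov; exists s; split=> // x Ax.
    apply: contrapT => nx; apply: nB; exists x; split=> // i si fx.
    by apply: nx; exists i.
  apply: filter_from_filter; first by exists [::].
  move=> s t Ps Pt; exists (s ++ t).
    by move=> i; rewrite mem_cat => /orP[/Ps|/Pt].
  move=> x [Ax nx]; split; split=> // i ii; apply: nx.
    by rewrite mem_cat ii.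
  by rewrite mem_cat ii orbT.
have FA : F A by exists [::] => // x [].
have [x [Ax clx]] := cA _ FF FA.
have [i Di fx] := cov x Ax.
have : F (B [:: i]) by exists [:: i] => // j; rewrite inE => /eqP ->.
move=> /clx /(_ (open_nbhs_nbhs (conj (fo i Di) fx))) [y [[_ /(_ i)]]].
by rewrite inE eqxx => /(_ isT).
Qed.

Lemma exists_mul_le (R : realType) (r e : R) : 0 <= r -> 0 < e ->
  exists2 d, 0 < d & r * d <= e.
Proof.
move=> r0 e0; exists (e / (r + 1)); first by rewrite divr_gt0// ltr_wpDl.
rewrite mulrCA ler_piMr// ?(ltW e0)// ler_pdivrMr ?mul1r ?lerDl//; lra.
Qed.

Lemma clipP (R : realType) (x e : R) : 0 < e ->
  let c := Num.max (- e) (Num.min e x) in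
  [/\ `|x - c| <= `|x|, `|c| <= e & `|x| < e -> c = x].
Proof.
move=> e0 /=; have [ex|xe] := leP e x.
  have -> : Num.max (- e) e = e by apply/max_idPr; lra.
  have -> : `|x - e| = x - e by rewrite ger0_norm//; lra.
  have -> : `|x| = x by rewrite ger0_norm//; lra.
  by rewrite gtr0_norm//; split=> //; lra.
have [ex|xe'] := leP (- e) x.
  by rewrite subrr normr0 normr_ge0 ler_norml; split=> //; lra.
rewrite normrN (gtr0_norm e0) (_ : `|x| = - x); last by rewrite ltr0_norm//; lra.
rewrite (_ : `|x - - e| = - (x - - e)); last by rewrite ltr0_norm//; lra.
by split=> //; lra.
Qed.

Section functionals.
Context {R : realType} {T : topologicalType}.
Hypotheses (cT : compact [set: T]) (hT : hausdorff_space T).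
Implicit Types (m : (T -> R) -> R) (U V : set T) (g h : T -> R).

(* An element of the dual of C(T) of norm at most [r].  It is total on [T -> R],
   with junk value 0 at discontinuous functions, so that the set of all of them is
   compact for the product topology indexed by [T -> R]. *)
Record bounded_functional (r : R) m : Prop := BoundedFunctional {
  bfun_lin : forall a g h, continuous g -> continuous h ->
    m (fun t => a * g t + h t) = a * m g + m h ;
  bfun_le : forall g, continuous g -> (forall t, `|g t| <= 1) -> `|m g| <= r ;
  bfun_junk : forall g, ~ continuous g -> m g = 0 }.

Definition test U : set (T -> R) :=
  [set h | [/\ continuous h, forall t, `|h t| <= 1 & forall t, ~ U t -> h t = 0]].

Definition support_fun (H : set (T -> R)) m : R := sup [set m h | h in H].

(* On an open set [U] this is |m|(U), and [outer] below is the outer measure |m|^*. *)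
Definition variation m U : R := support_fun (test U) m.

Lemma continuous_affine (a : R) g h : continuous g -> continuous h ->
  continuous (fun t => a * g t + h t).
Proof.
move=> cg ch x; apply: (@continuousD R R T (fun t => a * g t) h x _ (ch x)).
by apply: (@continuousM R T (fun=> a) g x _ (cg x)); exact: cvg_cst.
Qed.

Lemma continuous_mul g h : continuous g -> continuous h ->
  continuous (fun t => g t * h t).
Proof. by move=> cg ch x; exact: (@continuousM R T g h x (cg x) (ch x)). Qed.

Lemma cst_continuousR (a : R) : continuous (fun _ : T => a).
Proof. by move=> x; exact: cvg_cst. Qed.

Lemma continuous_minr g h : continuous g -> continuous h ->
  continuous (fun t => Num.min (g t) (h t)).
Proof. by move=> cg ch x; exact: (@continuous_min R T g h x (cg x) (ch x)). Qed.

Lemma continuous_maxr g h : continuous g -> continuous h ->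
  continuous (fun t => Num.max (g t) (h t)).
Proof. by move=> cg ch x; exact: (@continuous_max R T g h x (cg x) (ch x)). Qed.

Section variation.
Context (r : R) m (bm : bounded_functional r m).

Lemma bfunD g h : continuous g -> continuous h ->
  m (fun t => g t + h t) = m g + m h.
Proof.
move=> cg ch; rewrite -[m g]mul1r -(bfun_lin bm)//.
by congr m; apply/funext => t; rewrite mul1r.
Qed.

Lemma bfun0 : m (fun=> 0) = 0.
Proof.
have := bfunD (@cst_continuousR 0) (@cst_continuousR 0).
have -> : (fun _ : T => 0 + 0 : R) = fun=> 0 by apply/funext => t; rewrite addr0.
by lra.
Qed.

Lemma bfunZ (a : R) g : continuous g -> m (fun t => a * g t) = a * m g.
Proof.
move=> cg; rewrite -[RHS]addr0 -bfun0 -(bfun_lin bm)//; last exact: cst_continuousR.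
by congr m; apply/funext => t; rewrite addr0.
Qed.

Lemma bfunB g h : continuous g -> continuous h ->
  m (fun t => g t - h t) = m g - m h.
Proof.
move=> cg ch; rewrite -[in RHS]mulN1r addrC -(bfun_lin bm)//.
by congr m; apply/funext => t; rewrite mulN1r addrC.
Qed.

Lemma bfun_le_scale g (c : R) : 0 <= c -> continuous g ->
  (forall t, `|g t| <= c) -> `|m g| <= r * c.
Proof.
rewrite le_eqVlt => /predU1P[<-|c0] cg gc.
  have -> : g = fun=> 0.
    by apply/funext => t; apply/eqP; rewrite -normr_le0.
  by rewrite bfun0 normr0 mulr0.
have := bfun_le bm (g := fun t => c^-1 * g t).
rewrite bfunZ// normrM (gtr0_norm (x := c^-1)) ?invr_gt0// ler_pdivrMl// (mulrC c); apply.
  by move=> x; apply: continuous_mul => //; exact: cst_continuousR.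
by move=> t; rewrite normrM gtr0_norm ?invr_gt0// ler_pdivrMl// mulr1.
Qed.

Lemma test_le U h : test U h -> m h <= r.
Proof. by move=> [ch h1 _]; exact: le_trans (ler_norm _) (bfun_le bm ch h1). Qed.

Lemma test0 U : test U (fun=> 0).
Proof.
by split=> [|t|//]; [exact: cst_continuousR|rewrite normr0].
Qed.

Lemma testS U V : U `<=` V -> test U `<=` test V.
Proof. by move=> UV h [ch h1 h0]; split=> // t nV; apply: h0 => /UV. Qed.

Lemma has_sup_test U : has_sup [set m h | h in test U].
Proof.
split; first by exists (m (fun=> 0)), (fun=> 0) => //; exact: test0.
by exists r => _ [h th <-]; exact: test_le th.
Qed.

Lemma variation_ub U h : test U h -> m h <= variation m U.
Proof.
by move=> th; apply: ub_le_sup; [case: (has_sup_test U)|exists h].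
Qed.

Lemma ge_nrm U c : (forall h, test U h -> m h <= c) -> variation m U <= c.
Proof.
by move=> mc; apply: ge_sup; [case: (has_sup_test U)|move=> _ [h th <-]; exact: mc].
Qed.

Lemma variation_ge0 U : 0 <= variation m U.
Proof. by rewrite -bfun0; exact/variation_ub/test0. Qed.

Lemma variation_le U : variation m U <= r.
Proof. by apply: ge_nrm => h; exact: test_le. Qed.

Lemma variation_adherent U e : 0 < e -> exists2 h, test U h & variation m U - e < m h.
Proof.
by move=> e0; have [_ [h th <-] he] := sup_adherent e0 (has_sup_test U); exists h.
Qed.

Lemma variationS U V : U `<=` V -> variation m U <= variation m V.
Proof. by move=> UV; apply: ge_nrm => h /(testS UV); exact: variation_ub. Qed.

Lemma variation0 : variation m set0 = 0.
Proof.
apply/eqP; rewrite eq_le variation_ge0 andbT; apply: ge_nrm => h [_ _ h0].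
by rewrite (_ : h = fun=> 0) ?bfun0//; apply/funext => t; exact: h0.
Qed.

(** Subtracting from [h] its truncation to [[-e, e]] leaves a function that vanishes where
    [|h| < e], and [|h| >= e] is a closed subset of [U]. The truncation itself contributes at most
    [r * e]. *)
Lemma test_cut U h e : 0 < e -> test U h ->
  exists h' C, [/\ test U h', closed C, C `<=` U, (forall t, ~ C t -> h' t = 0) &
    m h <= m h' + r * e].
Proof.
move=> e0 [ch h1 h0].
pose k t := Num.max (- e) (Num.min e (h t)).
have ck : continuous k.
  apply: continuous_maxr; first exact: cst_continuousR.
  by apply: continuous_minr => //; exact: cst_continuousR.
have kP t := clipP (h t) e0.
exists (fun t => h t - k t), [set t | e <= `|h t|]; split.
- split=> [|t|t /h0 h0t].
  + by move=> x; apply: (@continuousB R R T h k x (ch x) (ck x)).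
  + by have [A _ _] := kP t; exact: le_trans (h1 t).
  + by have [A _ _] := kP t; move: A; rewrite -/(k t); rewrite h0t normr0 normr_le0 => /eqP.
- rewrite (_ : [set _ | _] = (fun t => `|h t|) @^-1` [set x | e <= x])//.
  apply: preimage_closed; last exact: closed_ge.
  by move=> x _; apply: (@continuous_comp _ _ _ h (fun y : R => `|y|));
    [exact: ch|exact: norm_continuous].
- move=> t /= et; apply: contrapT => /h0 h0t; move: et; rewrite h0t normr0; lra.
- move=> t /= /negP; rewrite -ltNge => te; have [_ _ /(_ te)] := kP t.
  by rewrite -/(k t) => ->; rewrite subrr.
- rewrite bfunB//.
  have : m k <= r * e.
    apply: le_trans (ler_norm _) (bfun_le_scale (ltW e0) ck _).
    by move=> t; have [] := kP t.
  lra.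
Qed.

Lemma urysohn_closed_open C U : closed C -> open U -> C `<=` U ->
  exists u : T -> R, [/\ continuous u, forall t, 0 <= u t <= 1,
    forall t, C t -> u t = 1 & forall t, ~ U t -> u t = 0].
Proof.
move=> cC oU CU.
have /normal_separatorP : normal_space T by exact: compact_normal.
move=> /(_ R (~` U) C (open_closedC oU) cC) [].
  by apply/seteqP; split=> t //= [nU /CU].
move=> uT [E sep].
have : uniform_separator (~` U) C by exists uT, E.
move=> /(@uniform_separatorP T R)[u [cu ur u0 u1]]; exists u; split=> // t.
- by have := ur (u t); rewrite /= in_itv /=; apply; exists t.
- by move=> Ct; apply: u1; exists t.
- by move=> Ut; apply: u0; exists t.
Qed.

(** Partition of unity: after [test_cut] the function [k] is carried by a closed [C], and a Urysohn
    function [u], equal to 1 on [C \ V] and to 0 off [U], splits it into [k u], a test for [U], and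
    [k - k u], a test for [V]. *)
Lemma variationU U V : open U -> open V -> variation m (U `|` V) <= variation m U + variation m V.
Proof.
move=> oU oV; apply: ge_nrm => h th; apply/ler_addgt0Pr => e e0.
have r0 : 0 <= r := le_trans (variation_ge0 setT) (variation_le setT).
have [d d0 re] := exists_mul_le r0 e0.
have [k [C [[ck k1 _] cC CUV kC mhk]]] := test_cut d0 th.
have [u [cu u01 uA uU]] : exists u : T -> R, [/\ continuous u, forall t, 0 <= u t <= 1,
    forall t, (C `\` V) t -> u t = 1 & forall t, ~ U t -> u t = 0].
  apply: urysohn_closed_open => //.
    by rewrite setDE; apply: closedI => //; exact: open_closedC.
  by move=> t [/CUV[]].
have cku : continuous (fun t => k t * u t) by exact: continuous_mul.
have ckv : continuous (fun t => k t - k t * u t).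
  by move=> x; apply: (@continuousB R R T k _ x (ck x) (cku x)).
have mk : m k = m (fun t => k t * u t) + m (fun t => k t - k t * u t).
  by rewrite -bfunD//; congr m; apply/funext => t; rewrite addrC subrK.
have m1 : m (fun t => k t * u t) <= variation m U.
  apply: variation_ub; split=> // t => [|/uU ->]; last by rewrite mulr0.
  by rewrite normrM (ger0_norm (x := u t)); have /andP[] := u01 t; last first => // a b;
    rewrite mulr_ile1.
have m2 : m (fun t => k t - k t * u t) <= variation m V.
  apply: variation_ub; split=> // t => [|nV].
    rewrite -[X in X - _]mulr1 -mulrBr normrM; have /andP[a b] := u01 t.
    by rewrite (ger0_norm (x := 1 - u t)) ?subr_ge0// mulr_ile1// ?subr_ge0// gerBl.
  have [Ct|/kC ->] := pselect (C t); last by rewrite mul0r subrr.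
  by rewrite uA// mulr1 subrr.
lra.
Qed.

(** After [test_cut] the carrier is compact, so finitely many [G i] cover it and finite
    subadditivity suffices. *)
Lemma variation_bigcup (G : nat -> set T) (e : R) :
  (forall i, open (G i)) -> (forall i, variation m (G i) <= e / (2 ^ i.+1)%:R) ->
  variation m (\bigcup_i G i) <= e.
Proof.
move=> oG Ge; apply: ge_nrm => h th; apply/ler_addgt0Pr => d d0.
have r0 : 0 <= r := le_trans (variation_ge0 setT) (variation_le setT).
have [d' d0' re] := exists_mul_le r0 d0.
have [k [C [[ck k1 _] cC CG kC mhk]]] := test_cut d0' th.
have cC' : compact C := subclosed_compact cC cT (@subsetT _ _).
have [//||s [_ sC]] := @compact_finite_cover T C nat setT G cC'.
  by move=> x /CG [i _ Gx]; exists i.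
pose n := (\max_(i <- s) i).+1.
have oW j : open (\bigcup_(i < j) G i) by apply: bigcup_open.
(* The factor is the sum of the first [j] weights [1 / 2^(i+1)]. *)
have mW j : variation m (\bigcup_(i < j) G i) <= e * (1 - (2 ^ j)%:R^-1).
  elim: j => [|j IH].
    by rewrite bigcup_mkord big_ord0 variation0 expn0 invr1 subrr mulr0.
  rewrite bigcup_mkord big_ord_recr /= -bigcup_mkord.
  apply: le_trans (variationU (oW j) (oG j)) _.
  apply: le_trans (lerD IH (Ge j)) _; rewrite expnS natrM invfM.
  set x := (2 ^ j)%:R^-1; lra.
have e0 : 0 <= e.
  have := le_trans (variation_ge0 _) (Ge 0%N); rewrite expn1; lra.
have : m k <= variation m (\bigcup_(i < n) G i).
  apply: variation_ub; split=> // t nG; apply: kC => /sC [i si Gt]; apply: nG.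
  by exists i => //=; rewrite /n ltnS; apply: leq_bigmax_seq.
move=> /le_trans/(_ (mW n)).
have : 0 <= e * (2 ^ n)%:R^-1 by rewrite mulr_ge0// invr_ge0.
rewrite mulrBr; lra.
Qed.

(** Let [k], carried by [C], nearly norm [m] on [U]. A test [l] for [V \ C] has a disjoint carrier,
    so [l + k] is a test for [V], and [m l] is at most what [k] leaves over. *)
Lemma variation_approx U V e : 0 < e -> U `<=` V -> exists C, [/\ closed C, C `<=` U &
  variation m (V `\` C) <= variation m V - variation m U + e].
Proof.
move=> e0 UV; have e2 : 0 < e / 2 by lra.
have r0 : 0 <= r := le_trans (variation_ge0 setT) (variation_le setT).
have [d d0 re] := exists_mul_le r0 e2.
have [h th mh] := variation_adherent U e2.
have [k [C [[ck k1 kU] cC CU kC mhk]]] := test_cut d0 th.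
exists C; split=> //; apply: ge_nrm => l [cl l1 l0].
suff : m (fun t => l t + k t) <= variation m V by rewrite bfunD//; lra.
apply: variation_ub; split=> [|t|t nV].
- by move=> x; apply: (@continuousD R R T l k x (cl x) (ck x)).
- have [Ct|/kC ->] := pselect (C t); last by rewrite addr0.
  by rewrite l0 ?add0r//; case.
- by rewrite l0 ?add0r; [apply: kU => /UV|case].
Qed.

Definition outer (A : set T) : R :=
  inf [set variation m U | U in [set U | open U /\ A `<=` U]].

Let has_inf_outer A : has_inf [set variation m U | U in [set U | open U /\ A `<=` U]].
Proof.
split; first by exists (variation m setT), setT => //; split; [exact: openT|].
by exists 0 => _ [U _ <-]; exact: variation_ge0.
Qed.

Lemma outer_le A U : open U -> A `<=` U -> outer A <= variation m U.
Proof.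
by move=> oU AU; apply: ge_inf; [case: (has_inf_outer A)|exists U].
Qed.

Lemma le_outer A c : (forall U, open U -> A `<=` U -> c <= variation m U) -> c <= outer A.
Proof.
move=> cU; apply: lb_le_inf; first by case: (has_inf_outer A).
by move=> _ [U [oU AU] <-]; exact: cU.
Qed.

Lemma outer_open U : open U -> outer U = variation m U.
Proof.
move=> oU; apply/eqP; rewrite eq_le outer_le//=.
by apply: le_outer => V _; exact: variationS.
Qed.

Lemma outer_adherent A e : 0 < e ->
  exists U, [/\ open U, A `<=` U & variation m U < outer A + e].
Proof.
by move=> e0; have [_ [U [oU AU] <-] ?] := inf_adherent e0 (has_inf_outer A); exists U.
Qed.

Lemma outerS A B : A `<=` B -> outer A <= outer B.
Proof. by move=> AB; apply: le_outer => U oU BU; apply: outer_le => // t /AB/BU. Qed.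

Lemma outer_ge0 A : 0 <= outer A.
Proof. by apply: le_outer => U _ _; exact: variation_ge0. Qed.

Lemma outer0 : outer set0 = 0.
Proof. by rewrite outer_open ?variation0//; exact: open0. Qed.

Lemma outerU A B : outer (A `|` B) <= outer A + outer B.
Proof.
apply/ler_addgt0Pr => e e0; have e2 : 0 < e / 2 by lra.
have [U [oU AU Ue]] := outer_adherent A e2.
have [V [oV BV Ve]] := outer_adherent B e2.
have := outer_le (openU oU oV) (setUSS AU BV); have := variationU oU oV; lra.
Qed.

Definition outer_measurable E :=
  forall A, outer A = outer (A `&` E) + outer (A `\` E).

Lemma outer_measurableW E :
  (forall A, outer (A `&` E) + outer (A `\` E) <= outer A) -> outer_measurable E.
Proof.
move=> H A; apply/eqP; rewrite eq_le H andbT.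
by apply: le_trans (outerU _ _); rewrite setDE -setIUr setUv setIT.
Qed.

(** Inside an open [V] containing [A], the set [V \ U] need not be open. Removing a closed inner
    approximation [C] of [V & U] gives the open set [V \ C], which still contains [A \ U] and has
    almost the right variation. *)
Lemma open_outer_measurable U : open U -> outer_measurable U.
Proof.
move=> oU; apply: outer_measurableW => A; apply: le_outer => V oV AV.
apply/ler_addgt0Pr => e e0.
have [C [cC CVU Ce]] := @variation_approx (V `&` U) V e e0 (@subIsetl _ _ _).
have oVC : open (V `\` C) by rewrite setDE; apply: openI => //; exact: closed_openC.
have A1 : outer (A `&` U) <= variation m (V `&` U).
  by apply: outer_le; [exact: openI|exact: setSI].
have A2 : outer (A `\` U) <= variation m (V `\` C).
  by apply: outer_le => // t [/AV Vt nU]; split=> // /CVU [].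
lra.
Qed.

Lemma outer_measurableC E : outer_measurable E -> outer_measurable (~` E).
Proof. by move=> mE A; rewrite setDE setCK addrC -setDE -mE. Qed.

Lemma outer_measurableI E F :
  outer_measurable E -> outer_measurable F -> outer_measurable (E `&` F).
Proof.
move=> mE mF A; rewrite (mE A) (mF (A `&` E)) (mE (A `\` (E `&` F))) -setIA -addrA.
congr (_ + (outer _ + outer _)); apply/seteqP; split=> t /=.
- by move=> [[At Et] nF]; split=> //; split=> // -[].
- by move=> [[At nEF] Et]; split=> // Ft; apply: nEF.
- by move=> [At nE]; split=> //; split=> // -[].
- by move=> [[At _] nE].
Qed.

Lemma outer_measurableD E F :
  outer_measurable E -> outer_measurable F -> outer_measurable (E `\` F).
Proof.
by move=> mE mF; rewrite setDE; apply: outer_measurableI => //; exact: outer_measurableC.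
Qed.

Lemma closed_approx U e : 0 < e -> open U -> exists C, [/\ closed C, C `<=` U &
  variation m (U `\` C) <= e].
Proof.
move=> e0 oU; have [C [cC CU Ce]] := variation_approx e0 (@subset_refl _ U).
by exists C; split=> //; rewrite subrr add0r in Ce.
Qed.

End variation.

End functionals.


(** * Delta-systems of open sets *)

(** Subtract the threshold [tau] from every term: the common terms cancel, the rest of [s] is
    nonnegative, the rest of [F] is nonpositive, and the lengths settle the multiples of [tau]. *)
Lemma top_sum (R : realType) (I : eqType) (c : I -> R) (tau : R) (s F : seq I) :
  0 <= tau -> uniq s -> uniq F -> (size F <= size s)%N ->
  (forall i, i \in s -> tau <= c i) ->
  (forall i, i \in F -> i \notin s -> c i <= tau) ->
  \sum_(i <- F) c i <= \sum_(i <- s) c i.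
Proof.
move=> t0 us uF Fs sc Fc.
have sumE (l : seq I) : \sum_(i <- l) c i = \sum_(i <- l) (c i - tau) + (size l)%:R * tau.
  rewrite [X in X + _]big_split /= sumrN big_const_seq count_predT iter_addr addr0.
  by rewrite mulr_natl subrK.
rewrite !sumE lerD//; last by rewrite ler_wpM2r// ler_nat.
have F1 : \sum_(i <- F | i \notin s) (c i - tau) <= 0.
  by rewrite big_seq_cond; apply: sumr_le0 => i /andP[iF /(Fc _ iF)]; rewrite subr_le0.
have s1 : 0 <= \sum_(i <- s | i \notin F) (c i - tau).
  by rewrite big_seq_cond; apply: sumr_ge0 => i /andP[/sc]; rewrite subr_ge0.
have E : \sum_(i <- F | i \in s) (c i - tau) = \sum_(i <- s | i \in F) (c i - tau).
  rewrite -big_filter -[RHS]big_filter; apply: perm_big.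
  by apply: uniq_perm; rewrite ?filter_uniq// => i; rewrite !mem_filter andbC.
rewrite (bigID (mem s)) /= [leRHS](bigID (mem F)) /=; lra.
Qed.

Section hulls.
Context {R : realType} {T : topologicalType}.
Implicit Types (m : (T -> R) -> R) (U V S : set T) (D : set (set T)).

Lemma bounded_functionalD r s m n : @bounded_functional R T r m ->
  bounded_functional s n -> bounded_functional (r + s) (fun g => m g + n g).
Proof.
move=> bm bn; split=> [a g h cg ch|g cg g1|g ncg].
- by rewrite (bfun_lin bm)// (bfun_lin bn)//; ring.
- apply: le_trans (ler_normD _ _) _.
  by rewrite lerD ?(bfun_le bm)// (bfun_le bn).
- by rewrite (bfun_junk bm)// (bfun_junk bn)// addr0.
Qed.

Lemma bounded_functionalZ r (a : R) m : @bounded_functional R T r m ->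
  bounded_functional (`|a| * r) (fun g => a * m g).
Proof.
move=> bm; split=> [b g h cg ch|g cg g1|g ncg].
- by rewrite (bfun_lin bm)//; ring.
- by rewrite normrM ler_wpM2l// (bfun_le bm).
- by rewrite (bfun_junk bm)// mulr0.
Qed.

Lemma support_fun_ub r m (H : set (T -> R)) h : bounded_functional r m ->
  H `<=` test setT -> H h -> m h <= support_fun H m.
Proof.
move=> bm HT Hh; apply: ub_le_sup; last by exists h.
by exists r => _ [k /HT tk <-]; have := test_le bm tk.
Qed.

Lemma ge_support_fun m (H : set (T -> R)) c : H !=set0 ->
  (forall h, H h -> m h <= c) -> support_fun H m <= c.
Proof.
by move=> [h Hh] mc; apply: ge_sup; [exists (m h), h|move=> _ [k Hk <-]; exact: mc].
Qed.

Definition hull S (F : seq (set T)) := S `|` \bigcup_(A in [set` F]) A.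

Lemma hull_nil S : hull S [::] = S.
Proof. by rewrite -[RHS]setU0; congr (_ `|` _); apply/seteqP; split=> t // []. Qed.

Lemma hull_open D S F : open S -> (forall A, D A -> open A) ->
  (forall A, A \in F -> D A) -> open (hull S F).
Proof.
by move=> oS oD FD; apply: openU => //; apply: bigcup_open => A /= /FD/oD.
Qed.

(* [support_fun (hull_tests D S k) m] is the supremum of |m| over the unions of [S]
   with at most [k] members of [D]; for a delta-system with kernel [S] it is |m|(S)
   plus the [k] largest values of |m|(A \ S). *)
Definition hull_tests D S (k : nat) : set (T -> R) := [set h | exists F,
  [/\ (size F <= k)%N, forall A, A \in F -> D A & test (hull S F) h]].

Lemma hull_tests_test D S k : hull_tests D S k `<=` test setT.
Proof. by move=> h [F [_ _]]; exact: testS. Qed.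

Lemma hull_tests_nonempty D S k : hull_tests D S k !=set0.
Proof. by exists (fun=> 0), [::]; split=> //; exact: test0. Qed.

Lemma variation_hull_le r m D S k F : bounded_functional r m ->
  (size F <= k)%N -> (forall A, A \in F -> D A) ->
  variation m (hull S F) <= support_fun (hull_tests D S k) m.
Proof.
move=> bm Fk FD; apply: (ge_nrm bm) => h th.
by apply: (support_fun_ub bm (@hull_tests_test D S k)); exists F.
Qed.

(** A hull ignores repetitions in its list, so duplicate-free lists suffice; [outer_hull] is
    additive only over those. *)
Lemma support_fun_hull_le r m D S k c : bounded_functional r m ->
  (forall F, (size F <= k)%N -> uniq F -> (forall A, A \in F -> D A) ->
    variation m (hull S F) <= c) ->
  support_fun (hull_tests D S k) m <= c.
Proof.
move=> bm Fc; apply: ge_support_fun; first exact: hull_tests_nonempty.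
move=> h [F [Fk FD th]].
have /Fc : (size (undup F) <= k)%N by exact: leq_trans (size_undup _) Fk.
move=> /(_ (undup_uniq _)); rewrite (_ : hull S (undup F) = hull S F); last first.
  by congr (_ `|` _); apply: eq_bigcupl; split=> A /=; rewrite mem_undup.
move=> /(_ (fun A => _)) Fc'; apply: le_trans (variation_ub bm th) (Fc' _).
by move=> A; rewrite mem_undup => /FD.
Qed.

Hypotheses (cT : compact [set: T]) (hT : hausdorff_space T).

(** The cells [A \ S] are pairwise disjoint by the delta-property and measurable as differences of
    open sets, so Caratheodory's condition splits them off one at a time. *)
Lemma outer_hull r m D S (F : seq (set T)) : bounded_functional r m ->
  open S -> (forall A, D A -> open A) ->
  (forall A B, D A -> D B -> A <> B -> A `&` B `<=` S) ->
  uniq F -> (forall A, A \in F -> D A) ->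
  outer m (hull S F) = outer m S + \sum_(A <- F) outer m (A `\` S).
Proof.
move=> bm oS oD DS; elim: F => [|A F IH] /=.
  by move=> _ _; rewrite big_nil addr0 hull_nil.
move=> /andP[AF uF] FD.
have DA : D A by apply: FD; rewrite inE eqxx.
have FD' B : B \in F -> D B by move=> BF; apply: FD; rewrite inE BF orbT.
have mA : outer_measurable m (A `\` S).
  apply: outer_measurableD; apply: (open_outer_measurable cT hT bm) => //.
  exact: oD.
rewrite big_cons addrCA -IH// (mA (hull S (A :: F))).
congr (_ + _); congr (outer m _).
  apply/seteqP; split=> t /= [] //.
  by move=> At nS; split=> //; right; exists A => //; exact: mem_head.
apply/seteqP; split=> t /= [].
- move=> [St|[B /=]]; first by move=> _; left.
  rewrite inE => /predU1P[-> At|BF Bt] nt; last by right; exists B.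
  by left; apply: contrapT => nS; apply: nt.
- by move=> St; split; [left|case].
- move=> [B /= BF Bt]; split; first by right; exists B => //; exact: mem_behead.
  move=> [At nS]; apply: nS; apply: (DS A B) => //; first exact: FD'.
  by move=> AB; move: AF; rewrite AB BF.
Qed.

End hulls.

(** * Comparison of two functionals on one delta-system *)

Section pair.
Context {R : realType} {T : topologicalType}.
Hypotheses (cT : compact [set: T]) (hT : hausdorff_space T).
Context (r s : R) (m n : (T -> R) -> R).
Hypotheses (bm : bounded_functional r m) (bn : bounded_functional s n).
Let l g := m g + n g.
Let bl : bounded_functional (r + s) l := bounded_functionalD bm bn.
Hypothesis variation_top : variation l setT = variation m setT + variation n setT.

Let variation_add_le U : variation l U <= variation m U + variation n U.
Proof.
by apply: (ge_nrm bl) => h th; rewrite lerD// ?(variation_ub bm)// (variation_ub bn).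
Qed.

Let outer_add_le A : outer l A <= outer m A + outer n A.
Proof.
apply/ler_addgt0Pr => e e0; have e2 : 0 < e / 2 by lra.
have [U [oU AU Ue]] := outer_adherent bm A e2.
have [V [oV AV Ve]] := outer_adherent bn A e2.
have := outer_le bl (openI oU oV) (_ : A `<=` _).
move=> /(_ (fun t At => conj (AU _ At) (AV _ At))).
have := variation_add_le (U `&` V).
have := variationS bm (@subIsetl _ U V); have := variationS bn (@subIsetr _ U V); lra.
Qed.

(** Subadditivity holds on [U] and on its complement, and both sides are additive over these two
    sets. Equality in total therefore forces equality on each. *)
Lemma variationD U : open U -> variation l U = variation m U + variation n U.
Proof.
move=> oU; apply/eqP; rewrite eq_le variation_add_le /=.
have := open_outer_measurable cT hT bl oU setT.
have := open_outer_measurable cT hT bm oU setT.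
have := open_outer_measurable cT hT bn oU setT.
rewrite !setTI !(outer_open bl oU) !(outer_open bl openT) !(outer_open bm oU).
rewrite !(outer_open bm openT) !(outer_open bn oU) !(outer_open bn openT).
have := outer_add_le (setT `\` U); move: variation_top; lra.
Qed.

Lemma delta_eq (D : set (set T)) S : open S -> (forall A, D A -> open A) ->
  (forall A B, D A -> D B -> A <> B -> A `&` B `<=` S) ->
  (forall k, support_fun (hull_tests D S k) m = support_fun (hull_tests D S k) n) ->
  (forall k, support_fun (hull_tests D S k) l =
    support_fun (hull_tests D S k) m + support_fun (hull_tests D S k) n) ->
  forall A, D A -> outer m (A `\` S) = outer n (A `\` S).
Proof.
move=> oS oD DS eqmn eql A0 DA0.
have oh F : (forall A, A \in F -> D A) -> open (hull S F) by exact: hull_open.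
pose c A := outer m (A `\` S) + outer n (A `\` S).
have c_ge0 A : 0 <= c A by rewrite addr_ge0 ?(outer_ge0 bm)// (outer_ge0 bn).
have hullE F : uniq F -> (forall A, A \in F -> D A) ->
    variation l (hull S F) = outer m S + outer n S + \sum_(A <- F) c A.
  move=> uF FD; rewrite variationD; last exact: oh.
  rewrite -(outer_open bm); last exact: oh.
  rewrite -(outer_open bn); last exact: oh.
  rewrite (outer_hull cT hT bm oS oD DS)// (outer_hull cT hT bn oS oD DS)// big_split /=.
  ring.
have [c0|c0] := leP (c A0) 0.
  have := outer_ge0 bm (A0 `\` S); have := outer_ge0 bn (A0 `\` S).
  by move: c0; rewrite /c; lra.
(* If [F] consists of the [size F] cells of largest [c]-mass, the supremum for [l]
   is attained at [hull S F], hence so are those for [m] and [n], which agree. *)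
have opt F : uniq F -> (forall A, A \in F -> D A) ->
    (forall A, A \in F -> c A0 <= c A) -> (forall A, D A -> A \notin F -> c A <= c A0) ->
    outer m (hull S F) = outer n (hull S F).
  move=> uF FD cF cnF.
  have : support_fun (hull_tests D S (size F)) l <= variation l (hull S F).
    apply: (support_fun_hull_le bl) => F' sF' uF' FD'.
    rewrite !hullE// lerD2l; apply: (top_sum (ltW c0)) => // A /FD'; exact: cnF.
  rewrite eql variationD; last exact: oh.
  rewrite (outer_open bm); last exact: oh.
  rewrite (outer_open bn); last exact: oh.
  have := variation_hull_le S bm (leqnn _) FD; have := variation_hull_le S bn (leqnn _) FD.
  rewrite (eqmn (size F)); lra.
(* Apply [opt] to the cells heavier than [A0], without and with [A0]. *)
pose P F := [/\ uniq F, forall A, A \in F -> D A & forall A, A \in F -> c A0 < c A].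
(* The total mass is at most [r + s], so only finitely many cells are heavier than [A0], and a
   longest list of such cells contains them all. *)
have sizeP F : P F -> (size F)%:R * c A0 <= r + s.
  move=> [uF FD cF].
  have := variation_le bl (hull S F); rewrite hullE//.
  have := outer_ge0 bm S; have := outer_ge0 bn S.
  suff : (size F)%:R * c A0 <= \sum_(A <- F) c A by lra.
  rewrite mulr_natl -[_ *+ _]addr0 -iter_addr -count_predT -big_const_seq.
  by rewrite big_seq [leRHS]big_seq; apply: ler_sum => A /cF/ltW.
pose Q k := `[< exists2 F, P F & size F = k >].
have exQ : exists k, Q k by exists 0%N; apply/asboolP; exists [::].
have ubQ k : Q k -> (k <= Num.truncn ((r + s) / c A0))%N.
  move=> /asboolP[F /sizeP FP <-]; rewrite -(@ler_nat R).
  have h : (size F)%:R <= (r + s) / c A0 by rewrite ler_pdivlMr.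
  by rewrite ler_nat -(natrK (R := R) (size F)); apply: le_truncn.
case: (ex_maxnP exQ ubQ) => k /asboolP[F [uF FD cF] sF] maxk.
have Fout A : D A -> A \notin F -> c A <= c A0.
  move=> DA AF; rewrite leNgt; apply/negP => cA.
  have : Q k.+1.
    apply/asboolP; exists (A :: F); last by rewrite /= sF.
    split=> [|B|B]; first by rewrite /= AF.
      by rewrite inE => /predU1P[->|/FD].
    by rewrite inE => /predU1P[->|/cF].
  by move=> /maxk; rewrite ltnn.
have A0F : A0 \notin F by apply/negP => /cF; rewrite ltxx.
have e1 : outer m (hull S F) = outer n (hull S F) by apply: opt => // A /cF/ltW.
have FD0 A : A \in A0 :: F -> D A by rewrite inE => /predU1P[->|/FD].
have e2 : outer m (hull S (A0 :: F)) = outer n (hull S (A0 :: F)).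
  apply: opt => //; first by rewrite /= A0F.
    by move=> A; rewrite inE => /predU1P[->|/cF/ltW].
  by move=> A DA; rewrite inE negb_or => /andP[_ /Fout]; exact.
move: e1 e2; rewrite !(outer_hull cT hT bm oS oD DS)//= ?A0F//.
rewrite !(outer_hull cT hT bn oS oD DS)//= ?A0F//.
rewrite !big_cons; lra.
Qed.

End pair.


(** * Rigidity of functionals with the same variation *)

(** The [k]-th summand is the length of the part of [[k, k+1]] below [y]. *)
Lemma clip_sum (R : realType) (N : nat) (y : R) : 0 <= y <= N%:R ->
  \sum_(k < N) Num.max 0 (Num.min 1 (y - k%:R)) = y.
Proof.
elim: N y => [|N IH] y /andP[y0 yN].
  by rewrite big_ord0; apply/eqP; rewrite eq_le y0 yN.
rewrite big_ord_recr /=; have [yN'|yN'] := leP y N%:R.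
  rewrite IH ?y0// (min_idPr _) ?(max_idPl _) ?addr0//; lra.
have -> : \sum_(k < N) Num.max 0 (Num.min 1 (y - k%:R)) = \sum_(k < N) (1 : R).
  apply: eq_bigr => k _; have : (k : nat).+1%:R <= N%:R :> R by rewrite ler_nat.
  by rewrite -natr1 => kN; rewrite (min_idPl _) ?(max_idPr _)//; lra.
rewrite sumr_const card_ord -natr1 in yN *.
rewrite (min_idPr _) ?(max_idPr _)//; lra.
Qed.

Lemma clip01P (R : realType) (x : R) : let c := Num.max 0 (Num.min 1 x) in
  [/\ 0 <= c <= 1, x <= 0 -> c = 0 & 1 <= x -> c = 1].
Proof.
move=> /=; have [x1|x1] := leP 1 x; have [x0|x0] := leP 0 x; try have [y0|y0] := leP (0 : R) 1;
  by split => *; lra.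
Qed.

Section bounded.
Context {R : realType} {T : topologicalType}.
Hypothesis cT : compact [set: T].

Lemma compact_bounded_fun (g : T -> R) : continuous g ->
  exists2 c, 0 < c & forall t, `|g t| <= c.
Proof.
move=> cg; pose V (k : nat) := [set t | `|g t| < k%:R].
have oV k : setT k -> open (V k).
  move=> _; apply: (@open_comp _ _ (fun t => `|g t|) [set x | x < k%:R]).
    by move=> x _; apply: (@continuous_comp _ _ _ g (fun y : R => `|y|));
      [exact: cg|exact: norm_continuous].
  exact: open_lt.
have [|s [_ sT]] := compact_finite_cover cT oV.
  by move=> x _; exists (Num.truncn `|g x|).+1 => //=; rewrite /V /= truncnS_gt.
exists (\max_(k <- s) k).+1%:R; first by rewrite ltr0n.
move=> t; have [k ks] := sT t Logic.I; rewrite /V /= => /ltW/le_trans; apply.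
by rewrite ler_nat ltnW// ltnS; apply: leq_bigmax_seq.
Qed.

End bounded.

Section rigidity.
Context {R : realType} {T : topologicalType}.
Hypotheses (cT : compact [set: T]) (hT : hausdorff_space T).
Context (r s : R) (m n : (T -> R) -> R).
Hypotheses (bm : bounded_functional r m) (bn : bounded_functional s n).
Hypothesis variation_top :
  variation (fun g => m g + n g) setT = variation m setT + variation n setT.
Hypothesis variation_eq : forall U, open U -> variation m U = variation n U.

Lemma bfun_sum p (k : (T -> R) -> R) (bk : bounded_functional p k) (N : nat) (G : nat -> T -> R) :
  (forall i, continuous (G i)) ->
  k (fun t => \sum_(i < N) G i t) = \sum_(i < N) k (G i) /\
  continuous (fun t => \sum_(i < N) G i t).
Proof.
move=> cG; elim: N => [|N [IH cN]].
  rewrite big_ord0 (_ : (fun t => _) = fun=> 0); last by apply/funext => t; rewrite big_ord0.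
  by split; [rewrite (bfun0 bk)|exact: cst_continuousR].
have -> : (fun t => \sum_(i < N.+1) G i t) = fun t => (\sum_(i < N) G i t) + G N t.
  by apply/funext => t; rewrite big_ord_recr.
rewrite big_ord_recr /= -IH (bfunD bk)//; split=> //.
by move=> x; apply: (@continuousD R R T _ (G N) x (cN x) (cG N x)).
Qed.

(** The clipped factor [c] is 0 where [g <= j] and 1 where [g >= j+1]. So [c h] is a test for
    [{g > j}], while [h - c h] is a test for [{g < j+1}], which is disjoint from [{g > j+1}]; as [h]
    nearly norms [k], what [h - c h] cannot carry is left to [c h]. *)
Lemma layer_bounds p (k : (T -> R) -> R) (bk : bounded_functional p k)
    (h g : T -> R) (e : R) (j : nat) :
  test setT h -> variation k setT - e <= k h -> continuous g ->
  variation k [set t | j.+1%:R < g t] - e <=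
    k (fun t => Num.max 0 (Num.min 1 (g t - j%:R)) * h t) <=
  variation k [set t | j%:R < g t].
Proof.
move=> [ch h1 _] kh cg.
pose c t := Num.max 0 (Num.min 1 (g t - j%:R)); have cP t := clip01P (g t - j%:R).
have cc : continuous c.
  apply: continuous_maxr; first exact: cst_continuousR.
  apply: continuous_minr; first exact: cst_continuousR.
  by move=> x; apply: (@continuousB R R T g _ x (cg x)); exact: cvg_cst.
have cch : continuous (fun t => c t * h t) by exact: continuous_mul.
have og (a : R) : open [set t | a < g t].
  by apply: (@open_comp _ _ g [set x | a < x]); [move=> x _; exact: cg|exact: open_gt].
have og' (a : R) : open [set t | g t < a].
  by apply: (@open_comp _ _ g [set x | x < a]); [move=> x _; exact: cg|exact: open_lt].
apply/andP; split; last first.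
  apply: (variation_ub bk); split=> // t.
    have [/andP[c0 c1] _ _] := cP t.
    by rewrite normrM (ger0_norm c0) mulr_ile1.
  by move=> /= /negP; rewrite -leNgt -subr_le0 => gt; have [_ /(_ gt)] := cP t;
    rewrite /c => ->; rewrite mul0r.
have up : k (fun t => h t - c t * h t) <= variation k [set t | g t < j.+1%:R].
  apply: (variation_ub bk); split=> [x|t|t].
  - by apply: (@continuousB R R T h _ x (ch x) (cch x)).
  - have [/andP[c0 c1] _ _] := cP t.
    rewrite -[X in X - _]mul1r -mulrBl normrM.
    by rewrite (ger0_norm (x := 1 - _)) ?subr_ge0// mulr_ile1// ?subr_ge0// gerBl.
  - move=> /= /negP; rewrite -leNgt -natr1 => gt; have [_ _] := cP t.
    by rewrite /c => ->; rewrite ?mul1r ?subrr//; lra.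
rewrite (bfunB bk)// in up.
have := open_outer_measurable cT hT bk (og j.+1%:R) setT.
rewrite setTI (outer_open bk openT) (outer_open bk (og _)).
have : variation k [set t | g t < j.+1%:R] <= outer k ([set: T] `\` [set t | j.+1%:R < g t]).
  rewrite -(outer_open bk (og' _)); apply: (outerS bk) => t /= gt; split=> // gt'.
  by have := lt_trans gt gt'; rewrite ltxx.
rewrite -/c; lra.
Qed.

(** Amplification: [N g] consists of [N] layers, and on the [j]-th the two values differ by at most
    [b j - b (j+1) + e]. The differences telescope to at most the total variation, so dividing by a
    large [N] leaves only [e]. *)
Lemma layer_eq (h g : T -> R) (e : R) : test setT h ->
  variation m setT - e <= m h -> variation n setT - e <= n h ->
  continuous g -> (forall t, 0 <= g t <= 1) ->
  `|m (fun t => g t * h t) - n (fun t => g t * h t)| <= e.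
Proof.
move=> th mh nh cg g01; have [ch h1 _] := th.
set d := `|_|; rewrite leNgt; apply/negP => ed.
pose a := variation m setT; have a0 : 0 <= a := variation_ge0 bm setT.
suff H (N : nat) : N%:R * d <= a + N%:R * e.
  have := H (Num.truncn (a / (d - e))).+1.
  have := truncnS_gt (a / (d - e)); rewrite ltr_pdivrMr ?subr_gt0//.
  set N := _.+1%:R; lra.
pose G t := N%:R * g t.
have cG : continuous G by apply: continuous_mul => //; exact: cst_continuousR.
pose c j t := Num.max 0 (Num.min 1 (G t - j%:R)) * h t.
have cc j : continuous (c j).
  apply: continuous_mul => //; apply: continuous_maxr; first exact: cst_continuousR.
  apply: continuous_minr; first exact: cst_continuousR.
  by move=> x; apply: (@continuousB R R T G _ x (cG x)); exact: cvg_cst.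
have sumc p (k : (T -> R) -> R) (bk : bounded_functional p k) :
    N%:R * k (fun t => g t * h t) = \sum_(j < N) k (c j).
  rewrite -(bfun_sum bk N cc).1 -(bfunZ bk); last exact: continuous_mul.
  congr k; apply/funext => t; rewrite mulrA -mulr_suml; congr (_ * _).
  rewrite clip_sum// /G; have /andP[g0 g1] := g01 t.
  by rewrite mulr_ge0//= ler_piMr.
pose b (j : nat) := variation m [set t | j%:R < G t].
have oG (j : nat) : open [set t | j%:R < G t].
  by apply: (@open_comp _ _ G [set x | j%:R < x]); [move=> x _; exact: cG|exact: open_gt].
have dj j : `|m (c j) - n (c j)| <= b j - b j.+1 + e.
  have := layer_bounds bm j th mh cG; have := layer_bounds bn j th nh cG.
  rewrite -!variation_eq// -/(b j) -/(b j.+1) -/(c j) => /andP[A1 A2] /andP[A3 A4].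
  rewrite ler_norml; lra.
have -> : N%:R * d = `|\sum_(j < N) (m (c j) - n (c j))|.
  by rewrite sumrB -(sumc _ _ bm) -(sumc _ _ bn) -mulrBr normrM ger0_norm.
apply: le_trans (ler_norm_sum _ _ _) _.
apply: (@le_trans _ _ (\sum_(j < N) (b j - b j.+1 + e))).
  by apply: ler_sum => j _; exact: dj.
rewrite big_split /= sumr_const card_ord -[e *+ N]mulr_natl lerD2r.
have -> : \sum_(j < N) (b j - b j.+1) = b 0%N - b N.
  by rewrite -opprB -telescope_sumr// big_mkord -sumrN; apply: eq_bigr => j _; rewrite opprB.
have : b 0%N <= a by exact: (variationS bm).
by have := variation_ge0 bm [set t | N%:R < G t]; rewrite -/(b N); lra.
Qed.

(* If [h] nearly norms [m + n] it nearly norms both, so [m] and [n] nearly have the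
   same density [h] with respect to their common variation: [layer_eq] compares
   [m (g * h)] with [n (g * h)] by slicing [g] into layers, and
   [f = f h^2 + f (1 - h^2)], where the second term is small because
   [|h| + |1 - h^2| / 2 <= 1]. *)
Lemma variation_rigid g : continuous g -> m g = n g.
Proof.
(* The constant 6 is made of [e] for each of [p h] and [q h], and [2 e] for each of [2 * m w] and
   [2 * n w]. *)
have abs_eq e (f : T -> R) : 0 < e -> continuous f -> (forall t, `|f t| <= 1) ->
    `|m f - n f| <= 6 * e.
  move=> e0 cf f1.
  have [h th lh] := variation_adherent (bounded_functionalD bm bn) setT e0.
  rewrite variation_top in lh; have [ch h1 _] := th.
  have mh' := variation_ub bm th; have nh' := variation_ub bn th.
  have mh : variation m setT - e <= m h by lra.
  have nh : variation n setT - e <= n h by lra.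
  have cfh : continuous (fun t => f t * h t) by exact: continuous_mul.
  have fh1 t : `|f t * h t| <= 1 by rewrite normrM mulr_ile1.
  (* [layer_eq] requires a factor with values in [[0, 1]], hence the positive and negative parts of
     [f h]. *)
  pose p t := Num.max 0 (f t * h t); pose q t := Num.max 0 (- (f t * h t)).
  have cp : continuous p by apply: continuous_maxr => //; exact: cst_continuousR.
  have cq : continuous q.
    apply: continuous_maxr; first exact: cst_continuousR.
    by move=> x; exact: (@continuousN R R T _ x (cfh x)).
  have p01 t : 0 <= p t <= 1.
    by have := fh1 t; rewrite ler_norml /p => /andP[? ?]; apply/andP;
      have [?|?] := leP 0 (f t * h t); split; lra.
  have q01 t : 0 <= q t <= 1.
    by have := fh1 t; rewrite ler_norml /q => /andP[? ?]; apply/andP;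
      have [?|?] := leP 0 (- (f t * h t)); split; lra.
  have := layer_eq th mh nh cp p01; have := layer_eq th mh nh cq q01.
  have cph := continuous_mul cp ch; have cqh := continuous_mul cq ch.
  pose w t := 2^-1 * (f t * (1 - h t * h t)).
  have cw : continuous w.
    apply: continuous_mul; first exact: cst_continuousR.
    apply: continuous_mul => // x; apply: (@continuousB R R T (fun=> 1)).
      exact: cvg_cst.
    exact: continuous_mul.
  have tw (a : R) : `|a| = 1 -> test setT (fun t => a * w t + h t).
    move=> a1; split=> [|t|t /(_ Logic.I)//]; first exact: continuous_affine.
    apply: le_trans (ler_normD _ _) _; rewrite normrM a1 mul1r /w 2!normrM.
    rewrite (ger0_norm (x := 2^-1)) ?invr_ge0//.
    have h1t := h1 t; have f1t := f1 t.
    have hh : h t * h t = `|h t| * `|h t| by rewrite -normrM ger0_norm// -expr2 sqr_ge0.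
    rewrite hh (ger0_norm (x := 1 - _)); last by rewrite subr_ge0 mulr_ile1.
    have : 0 <= (1 - `|f t|) * (1 - `|h t| * `|h t|).
      by rewrite mulr_ge0 ?subr_ge0// mulr_ile1.
    have := sqr_ge0 (1 - `|h t|); rewrite expr2; set F := `|f t|; set H := `|h t|; lra.
  have t1 : test setT (fun t => 1 * w t + h t) by apply: tw; rewrite normr1.
  have t2 : test setT (fun t => -1 * w t + h t) by apply: tw; rewrite normrN1.
  (* Both [h + w] and [h - w] are tests, and [h] is within [e] of the supremum, so neither sign of
     [w] gains more than [e]. *)
  have wm : `|m w| <= e.
    have := variation_ub bm t1; have := variation_ub bm t2.
    rewrite !(bfun_lin bm)// ler_norml; lra.
  have wn : `|n w| <= e.
    have := variation_ub bn t1; have := variation_ub bn t2.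
    rewrite !(bfun_lin bn)// ler_norml; lra.
  have fE u (k : (T -> R) -> R) (bk : bounded_functional u k) :
      k f = k (fun t => p t * h t) - k (fun t => q t * h t) + 2 * k w.
    rewrite -(bfunB bk)// addrC -(bfun_lin bk)//; last first.
      by move=> x; apply: (@continuousB R R T _ _ x (cph x) (cqh x)).
    congr k; apply/funext => t; rewrite -mulrBl.
    have -> : p t - q t = f t * h t.
      by rewrite /p /q; have [?|?] := leP 0 (f t * h t); have [?|?] := leP 0 (- (f t * h t)); lra.
    by rewrite /w; field.
  rewrite (fE _ _ bm) (fE _ _ bn).
  move: wm wn; rewrite !ler_norml => /andP[? ?] /andP[? ?] /andP[? ?] /andP[? ?].
  apply/andP; split; lra.
move=> cg; have [c c0 gc] := compact_bounded_fun cT cg.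
pose f t := c^-1 * g t.
have cf : continuous f by apply: continuous_mul => //; exact: cst_continuousR.
have f1 t : `|f t| <= 1.
  by rewrite /f normrM gtr0_norm ?invr_gt0// mulrC ler_pdivrMr ?mul1r.
have E : m f = n f.
  apply/eqP; rewrite -subr_eq0 -normr_le0; apply/ler_addgt0Pr => e e0; rewrite add0r.
  have e6 : 0 < e / 6 by rewrite divr_gt0.
  by have := abs_eq _ f e6 cf f1; lra.
move: E; rewrite /f (bfunZ bm)// (bfunZ bn)//.
by move/mulfI; apply; rewrite invr_neq0// gt_eqF.
Qed.

End rigidity.


(** * From equal masses on cells to equal functionals *)

Section delta_systems.
Context {R : realType} {T : topologicalType}.
Hypotheses (cT : compact [set: T]) (hT : hausdorff_space T).
Context (A_ : nat -> set (set T)) (S_ : nat -> set T).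
Hypothesis A_open : forall i A, A_ i A -> open A.
Hypothesis S_open : forall i, open (S_ i).
Hypothesis A_delta : forall i A B, A_ i A -> A_ i B -> A <> B -> A `&` B `<=` S_ i.
Hypothesis A_sep : forall x y, x <> y -> exists i A, A_ i A /\
  (((A `\` S_ i) x /\ ~ (A `\` S_ i) y) \/ (~ (A `\` S_ i) x /\ (A `\` S_ i) y)).

(* The pairs [(meet_family I, join_open I)] are again delta-systems, with cells the
   finite intersections of the cells [A `\` S_ i]; hence a pi-system of cells. *)
Fixpoint meet_family (I : seq nat) : set (set T) :=
  if I is i :: J then [set A `&` B | A in A_ i & B in meet_family J] else [set setT].

Fixpoint join_open (I : seq nat) : set T :=
  if I is i :: J then S_ i `|` join_open J else set0.

Lemma meet_family_open I A : meet_family I A -> open A.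
Proof.
elim: I A => [A ->|i I IH _ [A AA [B /IH oB] <-]]; first exact: openT.
by apply: openI => //; exact: A_open AA.
Qed.

Lemma join_open_open I : open (join_open I).
Proof. by elim: I => [|i I IH] /=; [exact: open0|exact: openU]. Qed.

Lemma meet_family_delta I A B : meet_family I A -> meet_family I B -> A <> B ->
  A `&` B `<=` join_open I.
Proof.
elim: I A B => [A B -> -> //|i I IH _ _ [A AA [B BB] <-] [A' AA' [B' BB'] <-] ne] t.
move=> [[At Bt] [At' Bt']].
have [eA|neA] := pselect (A = A').
  by right; apply: (IH B B') => // eB; apply: ne; rewrite eA eB.
by left; exact: (A_delta AA AA' neA).
Qed.

Lemma meet_family_cat I J A B : meet_family I A -> meet_family J B ->
  meet_family (I ++ J) (A `&` B).
Proof.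
elim: I A => [A -> BJ|i I IH _ [A AA [C CC] <-] BJ]; first by rewrite setTI.
by exists A => //; exists (C `&` B); [exact: IH|rewrite setIA].
Qed.

Lemma join_open_cat I J : join_open (I ++ J) = join_open I `|` join_open J.
Proof. by elim: I => [|i I IH] /=; [rewrite set0U|rewrite IH setUA]. Qed.

Context (r s : R) (m n : (T -> R) -> R).
Hypotheses (bm : bounded_functional r m) (bn : bounded_functional s n).
Let l g := m g + n g.
Let bl : bounded_functional (r + s) l := bounded_functionalD bm bn.
Hypothesis variation_top : variation l setT = variation m setT + variation n setT.
Hypothesis meet_family_eq : forall I k,
  support_fun (hull_tests (meet_family I) (join_open I) k) m =
  support_fun (hull_tests (meet_family I) (join_open I) k) n.
Hypothesis meet_family_add : forall I k,
  support_fun (hull_tests (meet_family I) (join_open I) k) l =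
  support_fun (hull_tests (meet_family I) (join_open I) k) m +
  support_fun (hull_tests (meet_family I) (join_open I) k) n.

Let cell (E : set T) := exists I A, meet_family I A /\ E = A `\` join_open I.

Let cell_eq E : cell E -> outer m E = outer n E.
Proof.
move=> [I [A [IA ->]]].
by apply: (delta_eq cT hT bm bn variation_top (join_open_open I)
  (@meet_family_open I) (@meet_family_delta I)).
Qed.

Let cellI E F : cell E -> cell F -> cell (E `&` F).
Proof.
move=> [I [A [IA ->]]] [J [B [JB ->]]].
exists (I ++ J), (A `&` B); split; first exact: meet_family_cat.
rewrite join_open_cat; apply/seteqP; split=> t /=.
  by move=> [[At nI] [Bt nJ]]; split=> // -[].
by move=> [[At Bt] nIJ]; split; split=> // ?; apply: nIJ; [left|right].
Qed.

Let cell_measurable E : cell E -> outer_measurable m E /\ outer_measurable n E.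
Proof.
move=> [I [A [IA ->]]]; split; apply: outer_measurableD.
- by apply: (open_outer_measurable cT hT bm); exact: meet_family_open IA.
- by apply: (open_outer_measurable cT hT bm); exact: join_open_open.
- by apply: (open_outer_measurable cT hT bn); exact: meet_family_open IA.
- by apply: (open_outer_measurable cT hT bn); exact: join_open_open.
Qed.

Let cellT : cell setT.
Proof. by exists [::], setT; split=> //=; rewrite setD0. Qed.

(* [B] is any union of atoms of the algebra generated by [Q]. *)
Let cell_algebra_eq (Q : seq (set T)) : (forall E, E \in Q -> cell E) ->
  forall B : set T,
    (forall x y, (forall E, E \in Q -> (E x <-> E y)) -> B x -> B y) ->
    forall E, cell E -> outer m (E `&` B) = outer n (E `&` B).
Proof.
elim: Q => [_ B satB E cE|F Q IH cQ B satB E cE].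
  have [[x Bx]|nB] := pselect (B !=set0).
    rewrite (_ : B = setT) ?setIT; first exact: cell_eq.
    by apply/seteqP; split=> // y _; exact: (satB x).
  rewrite (_ : B = set0) ?setI0 ?(outer0 bm) ?(outer0 bn)//.
  by apply/seteqP; split=> // x Bx; apply: nB; exists x.
have cF : cell F by apply: cQ; exact: mem_head.
have {}IH := IH (fun E EQ => cQ E (mem_behead (s := F :: Q) EQ)).
pose same x y := forall G, G \in Q -> (G x <-> G y).
(* [B1] and [B0] are the saturations, for the shorter list [Q], of the parts of [B] inside and
   outside [F]. They agree with [B] on [F] and off [F] respectively. *)
pose B1 := [set x | exists y, [/\ B y, F y & same y x]].
pose B0 := [set x | exists y, [/\ B y, ~ F y & same y x]].
have sat1 x y : same x y -> B1 x -> B1 y.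
  move=> xy [z [Bz Fz zx]]; exists z; split=> // G GQ.
  by rewrite (zx _ GQ); exact: xy.
have sat0 x y : same x y -> B0 x -> B0 y.
  move=> xy [z [Bz Fz zx]]; exists z; split=> // G GQ.
  by rewrite (zx _ GQ); exact: xy.
have E1 : E `&` B `&` F = (E `&` F) `&` B1.
  apply/seteqP; split=> x /=.
    by move=> [[Ex Bx] Fx]; split=> //; exists x; split.
  move=> [[Ex Fx] [y [By Fy yx]]].
  split=> //; split=> //; apply: (satB y) => // G.
  by rewrite inE => /predU1P[->|GQ]; [split|exact: yx].
have E0 : (E `&` B) `\` F = (E `&` B0) `\` F.
  apply/seteqP; split=> x /= [[Ex Bx] nF].
    by split=> //; split=> //; exists x; split.
  case: Bx => y [By Fy yx].
  split=> //; split=> //; apply: (satB y) => // G.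
  by rewrite inE => /predU1P[->|GQ]; [split|exact: yx].
have E0' : E `&` B0 `&` F = (E `&` F) `&` B0 by rewrite setIAC.
have [mF nF] := cell_measurable cF.
have cEF := cellI cE cF.
(* [E \ F] need not be a cell, so its share of [B0] is computed as that of [E] minus that of
   [E & F]. *)
rewrite (mF (E `&` B)) (nF (E `&` B)) E1 E0.
have := IH _ sat1 _ cEF; have := IH _ sat0 _ cE; have := IH _ sat0 _ cEF.
by rewrite (mF (E `&` B0)) (nF (E `&` B0)) E0'; lra.
Qed.

(** Choose a closed inner approximation [C] of each [A] and discard the small open set [A \ C]; what
    remains of [A] coincides with what remains of [C]. *)
Let open_list_closed (s0 : seq (set T)) (e : R) : 0 < e ->
  (forall A, A \in s0 -> open A) ->
  exists G, [/\ open G, variation l G <= e & forall A, A \in s0 -> closed (A `\` G)].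
Proof.
elim: s0 e => [e e0 _|A s0 IH e e0 oA].
  by exists set0; split=> //; [exact: open0|rewrite (variation0 bl) ltW].
have e2 : 0 < e / 2 by lra.
have [||G [oG Ge GA]] := IH (e / 2) => //.
  by move=> B Bs; apply: oA; rewrite inE Bs orbT.
have oAA : open A by apply: oA; exact: mem_head.
have [C [cC CA AC]] := closed_approx bl e2 oAA.
have oAC : open (A `\` C) by rewrite setDE; apply: openI => //; exact: closed_openC.
exists (G `|` (A `\` C)); split.
- exact: openU.
- by have := variationU cT hT bl oG oAC; lra.
- move=> B; rewrite inE => /predU1P[->|/GA cB].
    rewrite (_ : _ `\` _ = C `\` G).
      by rewrite setDE; apply: closedI => //; exact: open_closedC.
    apply/seteqP; split=> t /=.
      move=> [At nG]; split; last by move=> Gt; apply: nG; left.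
      by apply: contrapT => nC; apply: nG; right.
    by move=> [Ct nG]; split; [exact: CA|case=> // -[]].
  rewrite (_ : _ `\` _ = (B `\` G) `&` ~` (A `\` C)).
    by apply: closedI => //; exact: open_closedC.
  by rewrite setDE setCU setIA -setDE.
Qed.

(** For open [G], the set [E] is relatively clopen in the complement of [G]. *)
Let clopen_off (G E : set T) := closed (E `\` G) /\ closed (~` E `\` G).

Let clopen_offS G G' E : open G' -> G `<=` G' -> clopen_off G E -> clopen_off G' E.
Proof.
move=> oG' GG' [c1 c2].
have sub F : closed (F `\` G) -> closed (F `\` G').
  move=> cF; rewrite (_ : _ `\` _ = (F `\` G) `&` ~` G').
    by apply: closedI => //; exact: open_closedC.
  apply/seteqP; split=> t /=; first by move=> [? nG']; do !split=> //; move/GG'.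
  by move=> [[? ?] ?].
by split; exact: sub.
Qed.

(* Up to a small open set, the union of [A_ i] is compact, hence only finitely
   many cells meet it. *)
Let lusin1 i (e : R) : 0 < e -> exists G, [/\ open G, variation l G <= e &
  forall A, A_ i A -> clopen_off G (A `\` S_ i)].
Proof.
move=> e0; have e2 : 0 < e / 2 by lra.
pose O := S_ i `|` \bigcup_(A in A_ i) A.
have oO : open O.
  by apply: openU => //; apply: bigcup_open => A; exact: A_open.
have [|G1 [oG1 G1e G1O]] := @open_list_closed [:: O] _ e2.
  by move=> A; rewrite inE => /eqP ->.
have cO : closed (O `\` G1) by apply: G1O; exact: mem_head.
have kO : compact (O `\` G1) := subclosed_compact cO cT (@subsetT _ _).
have [|| s0 [s0A s0O]] :=
    @compact_finite_cover T _ _ (A_ i `|` [set S_ i]) id kO.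
- by move=> A [|->//]; exact: A_open.
- move=> x [[Sx|[A AA Ax]] _]; first by exists (S_ i) => //; right.
  by exists A => //; left.
have [|G2 [oG2 G2e G2A]] := @open_list_closed (S_ i :: s0) _ e2.
  by move=> A; rewrite inE => /predU1P[-> //|/s0A [|->//]]; exact: A_open.
have oG : open (G1 `|` G2) by exact: openU.
exists (G1 `|` G2); split=> //.
  by have := variationU cT hT bl oG1 oG2; lra.
move=> A AA.
have cS : closed (S_ i `\` G2) by apply: G2A; exact: mem_head.
have [As|nAs] := boolP (A \in s0).
  have cA : closed (A `\` G2) by apply: G2A; rewrite inE As orbT.
  apply: (clopen_offS oG (@subsetUr _ G1 G2)).
  split.
    rewrite (_ : _ `\` _ = (A `\` G2) `&` ~` S_ i).
      by apply: closedI => //; exact: open_closedC.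
    by apply/seteqP; split=> t /= [[? ?] ?].
  rewrite (_ : _ `\` _ = (~` A `&` ~` G2) `|` (S_ i `\` G2)).
    apply: closedU => //; apply: closedI; apply: open_closedC => //.
    exact: A_open AA.
  apply/seteqP; split=> t /=.
    move=> [nAS nG]; have [St|nS] := pselect (S_ i t); first by right.
    by left; split=> // At; apply: nAS.
  by move=> [[nA nG]|[St nG]]; split=> // -[].
(* Off [G1] and [G2], a point of [A] lies in [S_ i] or in a member of the finite subcover other than
   [A], hence in [S_ i] by the delta-property. The cell of [A] is thus empty there. *)
have AS t : A t -> ~ (G1 `|` G2) t -> S_ i t.
  move=> At nG; have [|V Vs Vt] := s0O t.
    by split; [right; exists A|move=> G1t; apply: nG; left].
  have [VA|<- //] := s0A V Vs.
  apply: (A_delta AA VA) => // AV; by move: nAs; rewrite AV Vs.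
split.
  rewrite (_ : _ `\` _ = set0); first exact: closed0.
  by apply/seteqP; split=> t //= [[At nS] nG]; apply: nS; exact: AS.
rewrite (_ : _ `\` _ = ~` (G1 `|` G2)); first exact: open_closedC.
apply/seteqP; split=> t /=; first by move=> [].
by move=> nG; split=> // -[At]; apply; exact: AS.
Qed.

(** Errors [e / 2^(i+1)] for the single systems allow one exceptional set for all of them. *)
Let lusin (e : R) : 0 < e -> exists G, [/\ open G, variation l G <= e &
  forall i A, A_ i A -> clopen_off G (A `\` S_ i)].
Proof.
move=> e0.
have /choice[G GP] i : exists G, [/\ open G, variation l G <= e / (2 ^ i.+1)%:R &
    forall A, A_ i A -> clopen_off G (A `\` S_ i)].
  by apply: lusin1; rewrite divr_gt0// ltr0n expn_gt0.
have oG : open (\bigcup_i G i) by apply: bigcup_open => i _; have [] := GP i.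
exists (\bigcup_i G i); split=> //.
  by apply: (variation_bigcup cT hT bl) => i; have [] := GP i.
move=> i A AA; have sub : G i `<=` \bigcup_i G i by move=> t Gt; exists i.
by have [_ _ /(_ A AA)] := GP i; exact: clopen_offS.
Qed.

(** Off [G] the cells are clopen, so being separated by a given cell is an open condition on the
    pairs in [F1 * F2]. By compactness finitely many cells separate all these pairs, and [B] is the
    saturation of [F1] for them. *)
Let separate (G F1 F2 : set T) : open G ->
  (forall i A, A_ i A -> clopen_off G (A `\` S_ i)) ->
  closed F1 -> closed F2 -> F1 `&` F2 = set0 -> F1 `<=` ~` G -> F2 `<=` ~` G ->
  exists B, [/\ F1 `<=` B, B `&` F2 = set0 & outer m B = outer n B].
Proof.
move=> oG Gcl cF1 cF2 F12 F1G F2G.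
pose D := [set E | exists i A, A_ i A /\ E = A `\` S_ i].
(* The pairs meeting [G] are included to make this set open in the whole square; [F1] and [F2] avoid
   [G]. *)
pose sep (E : set T) : set (T * T) := ~`
  ((fst @^-1` (E `\` G) `&` snd @^-1` (E `\` G)) `|`
   (fst @^-1` (~` E `\` G) `&` snd @^-1` (~` E `\` G))).
have osep E : D E -> open (sep E).
  move=> [i [A [AA ->]]]; have [c1 c2] := Gcl i A AA.
  apply: closed_openC; apply: closedU; apply: closedI.
  - by apply: preimage_closed => // x _; exact: cvg_fst.
  - by apply: preimage_closed => // x _; exact: cvg_snd.
  - by apply: preimage_closed => // x _; exact: cvg_fst.
  - by apply: preimage_closed => // x _; exact: cvg_snd.
have kF : compact (F1 `*` F2).
  by apply: compact_setX; apply: subclosed_compact cT _.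
have [|Q [QD Qsep]] := compact_finite_cover kF osep.
  move=> [x y] [/= F1x F2y]; have [|i [A [AA xy]]] := @A_sep x y.
    move=> xy; suff : (F1 `&` F2) x by rewrite F12.
    by split=> //; rewrite xy.
  exists (A `\` S_ i); first by exists i, A.
  by move=> [[[x1 _] [y1 _]]|[[x1 _] [y1 _]]]; case: xy => -[].
pose same x y := forall E, E \in Q -> (E x <-> E y).
exists [set y | exists2 x, F1 x & same x y]; split.
- by move=> x F1x; exists x.
- apply/seteqP; split=> // y /= [[x F1x xy] F2y].
  have [|E EQ] := Qsep (x, y); first by split.
  apply; have [Ex|nEx] := pselect (E x).
    left; exact: (conj (conj Ex (F1G _ F1x)) (conj ((xy _ EQ).1 Ex) (F2G _ F2y))).
  right; exact: (conj (conj nEx (F1G _ F1x))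
    (conj (fun Ey => nEx ((xy _ EQ).2 Ey)) (F2G _ F2y))).
- rewrite -[X in outer m X]setTI -[X in outer n X]setTI.
  apply: (@cell_algebra_eq Q) => //.
    move=> E /QD [i [A [AA ->]]]; exists [:: i], A; split.
      by exists A => //; exists setT => //; rewrite setIT.
    by rewrite /= setU0.
  move=> x y xy [z F1z zx]; exists z => // E EQ.
  by rewrite (zx _ EQ); exact: xy.
Qed.

(** By rigidity it suffices to compare variations on an open [U]. A closed inner approximation [C]
    of [U] and the complement of [U] are separated off [G] by a set [B] of equal masses. Passing
    from [U] to [B] costs at most [2 e], for [G] and [U \ C], and passing back at most [e], for
    [G]. *)
Lemma delta_functional_eq g : continuous g -> m g = n g.
Proof.
apply: (variation_rigid cT hT bm bn variation_top) => U oU.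
suff H (e : R) : 0 < e ->
    variation m U <= variation n U + 3 * e /\ variation n U <= variation m U + 3 * e.
  apply/eqP; rewrite eq_le; apply/andP; split; apply/ler_addgt0Pr => e e0;
    have e3 : 0 < e / 3 by rewrite divr_gt0.
    have := H _ e3; lra.
  have := H _ e3; lra.
move=> e0; have [G [oG Ge Gcl]] := lusin e0.
have [C [cC CU Ce]] := closed_approx bl e0 oU.
have oUC : open (U `\` C) by rewrite setDE; apply: openI => //; exact: closed_openC.
have [|||||B [F1B BF2 EB]] := @separate G (C `\` G) (~` U `\` G) oG Gcl.
- by rewrite setDE; apply: closedI => //; exact: open_closedC.
- by rewrite setDE; apply: closedI => //; exact: open_closedC.
- by apply/seteqP; split=> t // [[/CU Ut _] [nU _]].
- by move=> t [].
- by move=> t [].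
have BGU : B `\` G `<=` U.
  move=> t [Bt nG]; apply: contrapT => nU; have : (B `&` (~` U `\` G)) t by [].
  by rewrite BF2.
have up p (k : (T -> R) -> R) (bk : bounded_functional p k) :
    variation k (U `\` C) <= e -> variation k G <= e -> variation k U <= outer k B + 2 * e.
  move=> k1 k2; rewrite -(outer_open bk oU).
  have : outer k U <= outer k ((C `\` G) `|` (G `|` (U `\` C))).
    apply: (outerS bk) => t Ut; have [Ct|nC] := pselect (C t); last by right; right.
    by have [Gt|nG] := pselect (G t); [right; left|left].
  have := outerU cT hT bk (C `\` G) (G `|` (U `\` C)).
  have := outerU cT hT bk G (U `\` C).
  rewrite (outer_open bk oG) (outer_open bk oUC).
  have := outerS bk F1B; lra.
have down p (k : (T -> R) -> R) (bk : bounded_functional p k) :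
    variation k G <= e -> outer k B <= variation k U + e.
  move=> k2; rewrite -(outer_open bk oU).
  have : outer k B <= outer k ((B `\` G) `|` G).
    apply: (outerS bk) => t Bt.
    by have [Gt|nG] := pselect (G t); [right|left].
  have := outerU cT hT bk (B `\` G) G.
  rewrite (outer_open bk oG).
  have := outerS bk BGU; lra.
have := variationD cT hT bm bn variation_top oG; have := variationD cT hT bm bn variation_top oUC.
have := variation_ge0 bm G; have := variation_ge0 bn G.
have := variation_ge0 bm (U `\` C); have := variation_ge0 bn (U `\` C).
rewrite -/l => p1 p2 p3 p4 p5 p6.
have m1 : variation m (U `\` C) <= e by lra.
have m2 : variation m G <= e by lra.
have n1 : variation n (U `\` C) <= e by lra.
have n2 : variation n G <= e by lra.
have := up _ _ bm m1 m2; have := up _ _ bn n1 n2.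
have := down _ _ bm m2; have := down _ _ bn n2; rewrite EB; lra.
Qed.

End delta_systems.


(** * Gruenhage spaces *)

Section gruenhage.
Context {T : topologicalType} (U : set (set T)).
Hypothesis U_open : forall V, U V -> open V.

Definition common (F : seq (set T)) : set T := [set x | forall V, V \in F -> V x].

Definition layer (k : nat) : set (set T) := [set A | exists F,
  [/\ uniq F, size F = k, forall V, V \in F -> U V & A = common F]].

Definition over (k : nat) : set T := \bigcup_(A in layer k.+1) A.

Lemma layer_open k A : layer k A -> open A.
Proof.
move=> [F [_ _ FU ->]]; elim: F FU => [|V F IH] FU.
  by rewrite (_ : common _ = setT); [exact: openT|by apply/seteqP; split].
rewrite (_ : common _ = V `&` common F).
  apply: openI; first by apply/U_open/FU/mem_head.
  by apply: IH => W WF; apply: FU; exact: mem_behead.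
apply/seteqP; split=> x /=.
  by move=> Fx; split=> [|W WF]; apply: Fx; [exact: mem_head|exact: mem_behead].
by move=> [Vx Fx] W; rewrite inE => /predU1P[->//|/Fx].
Qed.

Lemma over_open k : open (over k).
Proof. by apply: bigcup_open => A; exact: layer_open. Qed.

(** Two lists of [k] members with different intersections are not permutations of each other, so a
    point common to both intersections lies in a member outside the first list, which makes [k+1]
    members. *)
Lemma layer_delta k A B : layer k A -> layer k B -> A <> B -> A `&` B `<=` over k.
Proof.
move=> [F [uF sF FU ->]] [G [uG sG GU ->]] ne x [Fx Gx].
have [sub|] := pselect {subset G <= F}.
  have [_ eFG] := uniq_min_size uG sub (eq_leq (etrans sF (esym sG))).
  by case: ne; apply/seteqP; split=> y /= yF V VF; apply: yF; [rewrite -eFG|rewrite eFG].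
move=> /existsNP[V /not_implyP[VG /negP VF]].
exists (common (V :: F)).
  exists (V :: F); split=> //=; [by rewrite VF|by rewrite sF|].
  by move=> W; rewrite inE => /predU1P[->|/FU//]; exact: GU.
by move=> W; rewrite inE => /predU1P[->|/Fx//]; exact: Gx.
Qed.

(** Duplicate-free lists of members through [y] have length at most [k], and a longest one exhausts
    these members. *)
Lemma finite_not_over k y : ~ over k y -> finite_set [set V | U V /\ V y].
Proof.
move=> noy.
pose P F := [/\ uniq F, forall V, V \in F -> U V & forall V, V \in F -> V y].
pose Q j := `[< exists2 F, P F & size F = j >].
have exQ : exists j, Q j by exists 0%N; apply/asboolP; exists [::].
have ubQ j : Q j -> (j <= k)%N.
  move=> /asboolP[F [uF FU Fy] <-]; rewrite leqNgt; apply/negP => kF; apply: noy.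
  exists (common (take k.+1 F)); last by move=> V /mem_take/Fy.
  exists (take k.+1 F); split=> //; [exact: take_uniq|by rewrite size_takel|].
  by move=> V /mem_take/FU.
case: (ex_maxnP exQ ubQ) => j /asboolP[F [uF FU Fy] sF] maxj.
apply/finite_seqP; exists F; apply/seteqP; split=> V /=; last first.
  by move=> VF; split; [exact: FU|exact: Fy].
move=> [UV Vy]; apply: contrapT => /negP VF.
have /maxj : Q j.+1.
  apply/asboolP; exists (V :: F); last by rewrite /= sF.
  split=> /=; first by rewrite VF.
    by move=> W; rewrite inE => /predU1P[->|/FU].
  by move=> W; rewrite inE => /predU1P[->|/Fy].
by rewrite ltnn.
Qed.

(** The first alternative is separation by a cell of [layer k]; the second, by [over k] itself, is
    the reason for the one-member systems in [gruenhage_delta]. *)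
Definition layer_sep x y := exists k,
  (exists2 A, layer k A & ((A `\` over k) x /\ ~ A y) \/ ((A `\` over k) y /\ ~ A x)) \/
  ((over k x /\ ~ over k y) \/ (over k y /\ ~ over k x)).

(** With [k] the exact number of members through [x], their intersection contains [x] but not [y],
    since [V] is one of them, and [x] is not in [over k]. *)
Lemma finite_layer_sep x y V : finite_set [set V | U V /\ V x] -> U V -> V x -> ~ V y ->
  layer_sep x y.
Proof.
move=> /finite_seqP[F0 F0E] UV Vx nVy; pose F := undup F0.
have FE W : (W \in F) <-> U W /\ W x.
  rewrite mem_undup; have : [set V | U V /\ V x] W = [set` F0] W by rewrite F0E.
  by move=> /= ->.
exists (size F); left; exists (common F).
  by exists F; split=> //; [exact: undup_uniq|move=> W /FE[]].
left; split; last by move=> /(_ V) Fy; apply: nVy; apply: Fy; apply/FE.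
split; first by move=> W /FE[].
move=> [_ [G [uG sG GU ->]] Gx].
have : {subset G <= F} by move=> W WG; apply/FE; split; [exact: GU|exact: Gx].
by move=> /(uniq_leq_size uG); rewrite sG ltnn.
Qed.

Lemma layer_sep_sym x y : layer_sep x y -> layer_sep y x.
Proof.
by move=> [k [[A Ak [H|H]]|[H|H]]]; exists k; (try (left; exists A => //)); (try by right);
  (try by left); right; (try by right); left.
Qed.

(** If [V] contains [y] rather than [x], let [k] bound the number of members through [x]. Either [y]
    is in [over k], which then separates, or [y] too lies in finitely many members and the roles can
    be exchanged. *)
Lemma finite_sep x y V : finite_set [set V | U V /\ V x] -> U V ->
  (V x /\ ~ V y) \/ (V y /\ ~ V x) -> layer_sep x y.
Proof.
move=> fx UV [[Vx nVy]|[Vy nVx]]; first exact: finite_layer_sep fx UV Vx nVy.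
have [F0 F0E] := (finite_seqP _).1 fx.
pose k := size F0.
have nox : ~ over k x.
  move=> [_ [G [uG sG GU ->]] Gx].
  have : {subset G <= F0}.
    move=> W WG; have : [set V | U V /\ V x] W by split; [exact: GU|exact: Gx].
    by rewrite F0E.
  by move=> /(uniq_leq_size uG); rewrite sG ltnn.
have [oy|noy] := pselect (over k y); first by exists k; right; right.
apply: layer_sep_sym; exact: finite_layer_sep (finite_not_over noy) UV Vy nVx.
Qed.

End gruenhage.

(* The base systems are the intersections of [k] members of the [n]-th family, with
   kernel the set of points lying in more than [k] members, and that set alone. *)
Lemma gruenhage_delta (T : topologicalType) : gruenhage_space T ->
  exists (A_ : nat -> set (set T)) (S_ : nat -> set T),
  [/\ forall i A, A_ i A -> open A, forall i, open (S_ i),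
      forall i A B, A_ i A -> A_ i B -> A <> B -> A `&` B `<=` S_ i &
      forall x y, x <> y -> exists i A, A_ i A /\
        (((A `\` S_ i) x /\ ~ (A `\` S_ i) y) \/ (~ (A `\` S_ i) x /\ (A `\` S_ i) y))].
Proof.
move=> [U [oU sepU]].
(* The boolean selects the kind of system; an index coding no triple gets the empty family,
   vacuously a delta-system. *)
pose A_ i := if @unpickle (nat * nat * bool)%type i is Some (n, k, b) then
  if b then layer (U n) k else [set over (U n) k] else set0.
pose S_ i := if @unpickle (nat * nat * bool)%type i is Some (n, k, b) then
  if b then over (U n) k else set0 else set0.
exists A_, S_; split.
- move=> i A; rewrite /A_; case: unpickle => [[[n k] []]|//].
    exact: layer_open (oU n) _ _.
  by move=> ->; exact: over_open (oU n) _.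
- move=> i; rewrite /S_; case: unpickle => [[[n k] []]|]; try exact: open0.
  exact: over_open (oU n) _.
- move=> i A B; rewrite /A_ /S_; case: unpickle => [[[n k] []]|//].
    exact: layer_delta.
  by move=> -> ->.
move=> x y xy; have [n [V [UV [z Vz] fin]]] := sepU x y xy.
have Vxy : (V x /\ ~ V y) \/ (V y /\ ~ V x).
  have zP : (V `&` [set x; y]) z by rewrite Vz.
  have VP t : V t -> [set x; y] t -> t = z.
    by move=> Vt txy; have : (V `&` [set x; y]) t by []; rewrite Vz.
  case: zP => Vzz [] zE; rewrite zE in Vzz VP; [left|right]; split=> // V'.
    by apply: xy; rewrite (VP y)//; right.
  by apply: xy; rewrite (VP x)//; left.
have [k sep] : layer_sep (U n) x y.
  case: fin => fin; first exact: finite_sep fin UV Vxy.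
  by apply: layer_sep_sym; apply: finite_sep fin UV _; case: Vxy; [right|left].
case: sep => [[A Ak AP]|oP].
  exists (pickle (n, k, true)), A; rewrite /A_ /S_ pickleK; split=> //.
  case: AP => [[Ax nA]|[Ay nA]]; [left|right]; split=> //; by case.
exists (pickle (n, k, false)), (over (U n) k); rewrite /A_ /S_ pickleK setD0; split=> //.
by case: oP => -[]; [left|right].
Qed.


(** * Weighted sums and lower semicontinuity *)

Section weighted_sum.
Context {R : realType}.
Implicit Types (a b c : nat -> R) (C : R).

Definition psum a (n : nat) : R := \sum_(i < n) (2 ^ i.+1)%:R^-1 * a i.

(** The sum of the series when the terms are nonnegative and bounded. Written as a supremum it
    inherits lower semicontinuity from its partial sums. *)
Definition wsum a : R := sup [set psum a n | n in [set: nat]].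

Let w_gt0 i : 0 < (2 ^ i.+1)%:R^-1 :> R.
Proof. by rewrite invr_gt0 ltr0n expn_gt0. Qed.

Lemma psum_le a C n : 0 <= C -> (forall i, a i <= C) -> psum a n <= C.
Proof.
move=> C0 aC; suff H : psum a n <= C * (1 - (2 ^ n)%:R^-1).
  by apply: le_trans H _; rewrite ler_piMr// gerBl invr_ge0.
rewrite /psum; elim: n => [|n IH]; first by rewrite big_ord0 expn0 invr1 subrr mulr0.
rewrite big_ord_recr /=; apply: le_trans (lerD IH (ler_wpM2l (ltW (w_gt0 n)) (aC n))) _.
by rewrite expnS natrM invfM; set x := (2 ^ n)%:R^-1; lra.
Qed.

Lemma wsum_le a C : (forall n, psum a n <= C) -> wsum a <= C.
Proof.
by move=> aC; apply: ge_sup; [exists (psum a 0), 0%N|move=> _ [n _ <-]].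
Qed.

Section bounded.
Context a C (a0 : forall i, 0 <= a i) (aC : forall i, a i <= C).

Lemma psum_le_wsum n : psum a n <= wsum a.
Proof.
apply: ub_le_sup; last by exists n.
by exists C => _ [k _ <-]; apply: psum_le => //; exact: le_trans (a0 0) (aC 0).
Qed.

Lemma wsum_ge0 : 0 <= wsum a.
Proof. by apply: le_trans (psum_le_wsum 0); rewrite /psum big_ord0. Qed.

Lemma wsum_ge_term i : (2 ^ i.+1)%:R^-1 * a i <= wsum a.
Proof.
apply: le_trans (psum_le_wsum i.+1); rewrite /psum big_ord_recr /= lerDr.
by apply: sumr_ge0 => j _; rewrite mulr_ge0// ltW.
Qed.

(** A strict inequality at one index [j] would lower the whole sum by the fixed amount [d]. *)
Lemma wsum_strict c : (forall i, 0 <= c i <= a i) -> wsum a <= wsum c -> a = c.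
Proof.
move=> ca ac; apply/funext => j; apply/eqP; rewrite eq_le.
have /andP[c0j caj] := ca j; rewrite caj andbT leNgt; apply/negP => lt.
pose d := (2 ^ j.+1)%:R^-1 * (a j - c j).
have d0 : 0 < d by rewrite mulr_gt0// subr_gt0.
suff : wsum c <= wsum a - d by lra.
apply: wsum_le => n; pose k := maxn n j.+1.
have cn : psum c n <= psum c k.
  rewrite /k; move: (leq_maxl n j.+1) => /subnK <-.
  elim: (_ - n)%N => [//|e IH]; apply: le_trans IH _.
  rewrite addSn /psum [leRHS]big_ord_recr /= lerDl mulr_ge0 ?(ltW (w_gt0 _))//.
  by case/andP: (ca (e + n)%N).
have jk : (j < k)%N by exact: leq_maxr.
have : d <= psum a k - psum c k.
  rewrite -sumrB (bigD1 (Ordinal jk)) //= -mulrBr -/d lerDl.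
  apply: sumr_ge0 => i _; rewrite -mulrBr mulr_ge0 ?(ltW (w_gt0 _))// subr_ge0.
  by case/andP: (ca i).
have := psum_le_wsum k; lra.
Qed.

End bounded.

Lemma wsum_comb a b c C (x y : R) : 0 <= x -> 0 <= y ->
  (forall i, 0 <= a i <= C) -> (forall i, 0 <= b i <= C) ->
  (forall i, c i <= x * a i + y * b i) -> wsum c <= x * wsum a + y * wsum b.
Proof.
move=> x0 y0 aP bP cab; apply: wsum_le => n.
have a0 i : 0 <= a i by case/andP: (aP i).
have b0 i : 0 <= b i by case/andP: (bP i).
have aC i : a i <= C by case/andP: (aP i).
have bC i : b i <= C by case/andP: (bP i).
have := psum_le_wsum a0 aC n; have := psum_le_wsum b0 bC n.
move=> /(ler_wpM2l y0) b1 /(ler_wpM2l x0) a1.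
apply: le_trans (lerD a1 b1); rewrite /psum !mulr_sumr -big_split /=.
apply: ler_sum => i _; rewrite !(mulrCA _ (_^-1)) -mulrDr.
by rewrite ler_wpM2l// ltW.
Qed.

End weighted_sum.

(** Convexity of the square at [x / t] and [y / (1 - t)]. Unlike the triangle inequality, this form
    survives sums and infima; [sqr_sum_le] leads back. *)
Lemma sqr_comb (R : realFieldType) (x y z t : R) : 0 < t < 1 -> 0 <= z -> z <= x + y ->
  z ^+ 2 <= t^-1 * x ^+ 2 + (1 - t)^-1 * y ^+ 2.
Proof.
move=> /andP[t0 t1] z0 zxy.
apply: (@le_trans _ _ ((x + y) ^+ 2)).
  by rewrite ler_sqr ?nnegrE// (le_trans z0).
have u0 : 0 < 1 - t by lra.
rewrite -subr_ge0 (_ : _ - _ = (t * (1 - t))^-1 * ((1 - t) * x - t * y) ^+ 2).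
  by rewrite mulr_ge0 ?sqr_ge0// invr_ge0 mulr_ge0 ?ltW.
by field; rewrite !gt_eqF.
Qed.

Section sublevel.
Context {R : realType} {Z : topologicalType} (B : set Z).
Implicit Types J : Z -> R.
Hypothesis cB : closed B.

(** Lower semicontinuity of [J] on the closed set [B]. *)
Definition sublevel_closed J := forall c, closed (B `&` [set z | J z <= c]).

Lemma sublevel_closed_ext J J' : (forall z, B z -> J z = J' z) ->
  sublevel_closed J -> sublevel_closed J'.
Proof.
move=> JJ' cJ c; rewrite (_ : _ `&` _ = B `&` [set z | J z <= c]); first exact: cJ.
by apply/seteqP; split=> z [Bz] /=; rewrite JJ'.
Qed.

Lemma sublevel_closed_cst (k : R) : sublevel_closed (fun=> k).
Proof.
move=> c; have [kc|kc] := leP k c.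
  by rewrite (_ : [set _ | _] = setT) ?setIT//; apply/seteqP; split.
by rewrite (_ : [set _ | _] = set0) ?setI0; [exact: closed0|apply/seteqP; split=> // z /=; rewrite leNgt kc].
Qed.

Lemma sublevel_closedD J1 J2 : sublevel_closed J1 -> sublevel_closed J2 ->
  sublevel_closed (fun z => J1 z + J2 z).
Proof.
move=> c1 c2 c.
rewrite (_ : _ `&` _ = \bigcap_(x in [set: R])
    ((B `&` [set z | J1 z <= x]) `|` (B `&` [set z | J2 z <= c - x]))).
  by apply: closed_bigI => x _; exact: closedU.
apply/seteqP; split=> z /=.
  move=> [Bz Jz] x _; have [J1x|J1x] := leP (J1 z) x; [left|right]; split=> //=; lra.
move=> Jx; have Bz : B z by case: (Jx 0 Logic.I) => -[].
split=> //; rewrite leNgt; apply/negP => lt.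
(* A level strictly between [c - J2 z] and [J1 z] violates both alternatives. *)
case: (Jx ((J1 z + (c - J2 z)) / 2) Logic.I) => -[_ /=]; lra.
Qed.

Lemma sublevel_closedZ (k : R) J : 0 < k -> sublevel_closed J ->
  sublevel_closed (fun z => k * J z).
Proof.
move=> k0 cJ c; rewrite (_ : [set _ | _] = [set z | J z <= k^-1 * c]); first exact: cJ.
by apply/seteqP; split=> z /=; rewrite ler_pdivlMl.
Qed.

Lemma sublevel_closed_sqr J : (forall z, B z -> 0 <= J z) -> sublevel_closed J ->
  sublevel_closed (fun z => J z ^+ 2).
Proof.
move=> J0 cJ c; have [c0|c0] := leP 0 c; last first.
  rewrite (_ : _ `&` _ = set0); first exact: closed0.
  apply/seteqP; split=> // z [_ /=]; have := sqr_ge0 (J z); lra.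
rewrite (_ : _ `&` _ = B `&` [set z | J z <= Num.sqrt c]); first exact: cJ.
have E z : B z -> (J z ^+ 2 <= c) = (J z <= Num.sqrt c).
  move=> Bz; rewrite -{1}(sqr_sqrtr c0) ler_sqr ?nnegrE ?sqrtr_ge0//; exact: J0.
by apply/seteqP; split=> z [Bz] /=; rewrite E.
Qed.

Lemma sublevel_closed_psum (J : Z -> nat -> R) n :
  (forall i, sublevel_closed (fun z => J z i)) -> sublevel_closed (fun z => psum (J z) n).
Proof.
move=> cJ; elim: n => [|n IH].
  apply: (@sublevel_closed_ext (fun=> 0)); last exact: sublevel_closed_cst.
  by move=> z _; rewrite /psum big_ord0.
apply: (@sublevel_closed_ext (fun z => psum (J z) n + (2 ^ n.+1)%:R^-1 * J z n)).
  by move=> z _; rewrite /psum big_ord_recr.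
apply: sublevel_closedD => //; apply: sublevel_closedZ => //.
Qed.

Lemma sublevel_closed_wsum (J : Z -> nat -> R) (C : R) :
  (forall z i, B z -> 0 <= J z i <= C) ->
  (forall i, sublevel_closed (fun z => J z i)) -> sublevel_closed (fun z => wsum (J z)).
Proof.
move=> JC cJ c.
rewrite (_ : _ `&` _ = B `&` \bigcap_(n in [set: nat]) (B `&` [set z | psum (J z) n <= c])).
  by apply: closedI => //; apply: closed_bigI => n _; exact: sublevel_closed_psum.
apply/seteqP; split=> z [Bz] /= Jz; split=> //.
  move=> n _; split=> //=; apply: le_trans Jz; apply: (@psum_le_wsum _ _ C) => i;
    by case/andP: (JC z i Bz).
by apply: wsum_le => n; have [] := Jz n Logic.I.
Qed.

(** Without a minimum, the open sets [V c] for attained values [c] would cover [B]. A point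
    attaining the least value of a finite subcover is in none of its sets. *)
Lemma sublevel_closed_min J z0 : compact B -> B z0 -> sublevel_closed J ->
  exists2 z, B z & forall z', B z' -> J z <= J z'.
Proof.
move=> kB Bz0 cJ; apply: contrapT => nmin.
pose V (c : R) := ~` (B `&` [set z | J z <= c]).
pose D := [set c | exists2 z, B z & J z = c].
have [||s [sD sB]] := @compact_finite_cover Z B R D V kB.
- by move=> c _; exact/closed_openC/cJ.
- move=> z Bz; apply: contrapT => nz; apply: nmin; exists z => // z' Bz'.
  rewrite leNgt; apply/negP => lt; apply: nz; exists (J z'); first by exists z'.
  by move=> [_ /=]; rewrite leNgt lt.
have : exists2 c, D c & forall i, i \in s -> c <= i.
  elim: s sD {sB} => [_|c s IH sD]; first by exists (J z0) => //; exists z0.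
  have [|d Dd ds] := IH; first by move=> i si; apply: sD; rewrite inE si orbT.
  have Dc : D c by apply: sD; exact: mem_head.
  have [cd|dc] := leP c d.
    exists c => // i; rewrite inE => /predU1P[->//|/ds]; exact: le_trans.
  exists d => // i; rewrite inE => /predU1P[->|/ds//]; exact: ltW.
move=> [c [z Bz Jz] cs]; have [i si] := sB z Bz.
by apply; split=> //=; rewrite Jz; exact: cs.
Qed.

End sublevel.


(** * The Hahn-Banach theorem *)

Section hahn_banach.
Context {R : realType} {V : lmodType R}.
Implicit Types p q : V -> R.

Record sublinear p : Prop := Sublinear {
  sublinearD : forall x y, p (x + y) <= p x + p y ;
  sublinearZ : forall (a : R) x, 0 <= a -> p (a *: x) = a * p x }.

Lemma sublinear0 p : sublinear p -> p 0 = 0.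
Proof. by move=> sp; rewrite -(scale0r 0) (sublinearZ sp)// mul0r. Qed.

Lemma sublinearN p x : sublinear p -> - p (- x) <= p x.
Proof.
by move=> sp; have := sublinearD sp x (- x); rewrite subrr sublinear0//; lra.
Qed.

(* The largest sublinear minorant of [p] whose value at [- y] is [- p y]. *)
Definition ray_reduce p y x : R :=
  inf [set p (x + t *: y) - t * p y | t in [set t : R | 0 <= t]].

Lemma ray_reduce_le p x y t : sublinear p -> 0 <= t ->
  ray_reduce p y x <= p (x + t *: y) - t * p y.
Proof.
move=> sp t0; apply: ge_inf; last by exists t.
exists (- p (- x)) => _ [u /= u0 <-].
have := sublinearD sp (x + u *: y) (- x).
rewrite addrAC subrr add0r (sublinearZ sp)//; lra.
Qed.

Lemma le_ray_reduce p x y c :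
  (forall t, 0 <= t -> c <= p (x + t *: y) - t * p y) -> c <= ray_reduce p y x.
Proof.
move=> H; apply: lb_le_inf; last by move=> _ [t t0 <-]; exact: H.
by exists (p (x + 0 *: y) - 0 * p y), 0 => //=.
Qed.

Lemma ray_reduce_le_self p x y : sublinear p -> ray_reduce p y x <= p x.
Proof.
by move=> sp; have := ray_reduce_le x y sp (lexx 0); rewrite scale0r addr0 mul0r subr0.
Qed.

Lemma ray_reduce_sublinear p y : sublinear p -> sublinear (ray_reduce p y).
Proof.
move=> sp; split=> [x z|a x a0].
  rewrite -lerBlDl; apply: le_ray_reduce => t t0.
  rewrite lerBlDr -lerBlDl; apply: le_ray_reduce => u u0.
  have := ray_reduce_le (x + z) y sp (addr_ge0 t0 u0).
  have := sublinearD sp (x + u *: y) (z + t *: y).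
  by rewrite addrACA (addrC (u *: y)) -scalerDl; lra.
have Zle b x' : 0 <= b -> ray_reduce p y (b *: x') <= b * ray_reduce p y x'.
  rewrite le_eqVlt => /predU1P[<-|b0].
    by rewrite scale0r mul0r -(sublinear0 sp); exact: ray_reduce_le_self.
  rewrite -ler_pdivrMl//; apply: le_ray_reduce => t t0.
  rewrite ler_pdivrMl//.
  have := ray_reduce_le (b *: x') y sp (mulr_ge0 (ltW b0) t0).
  by rewrite -scalerA -scalerDr (sublinearZ sp _ (ltW b0)) mulrBr mulrA.
apply/eqP; rewrite eq_le Zle//=.
have [->|an0] := eqVneq a 0.
  rewrite mul0r scale0r; apply: le_ray_reduce => t t0.
  by rewrite add0r (sublinearZ sp)// subrr.
have ap : 0 < a by rewrite lt_neqAle eq_sym an0.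
rewrite -ler_pdivlMl//; have := Zle a^-1 (a *: x).
by rewrite scalerA mulVf// scale1r; apply; rewrite invr_ge0.
Qed.

(** Zorn's lemma for the reversed order. The infimum of a chain is finite because [- p (- x)] bounds
    it below, and subadditive because any two members have a common minorant in the chain. *)
Lemma sublinear_minimal p : sublinear p ->
  exists q, [/\ sublinear q, forall x, q x <= p x &
    forall q', sublinear q' -> (forall x, q' x <= q x) -> q' = q].
Proof.
move=> sp; pose S := {q : V -> R | sublinear q /\ forall x, q x <= p x}.
pose r (s t : S) := `[< forall x, sval t x <= sval s x >].
have [||||[q [sq qp]] qmin] := @Zorn S r.
- by move=> t; apply/asboolP.
- by move=> s t u /asboolP st /asboolP tu; apply/asboolP => x; exact: le_trans (tu x) (st x).
- move=> [s Ps] [t Pt] /asboolP/= st /asboolP/= ts.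
  have E : s = t by apply/funext => x; apply/eqP; rewrite eq_le st ts.
  by subst t; congr exist; exact: Prop_irrelevance.
- move=> C totC; have [[c0 Cc0]|nC] := pselect (C !=set0); last first.
    exists (exist _ p (conj sp (fun x => lexx _))) => s Cs.
    by case: nC; exists s.
  pose q x := inf [set sval s x | s in C].
  have lbC x : has_lbound [set sval s x | s in C].
    exists (- p (- x)) => _ [s Cs <-]; case: s Cs => s /= [ss sp'] _.
    by have := sublinearN x ss; have := sp' (- x); lra.
  have qle s x : C s -> q x <= sval s x by move=> Cs; apply: ge_inf => //; exists s.
  have le_q c x : (forall s, C s -> c <= sval s x) -> c <= q x.
    move=> H; apply: lb_le_inf; first by exists (sval c0 x), c0.
    by move=> _ [s Cs <-]; exact: H.
  have sq : sublinear q.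
    split=> [x y|a x a0].
      rewrite -lerBlDl; apply: (le_q _ y) => s Cs; rewrite lerBlDr -lerBlDl; apply: (le_q _ x) => t Ct.
      rewrite lerBlDr.
      have [u [Cu us ut]] : exists u, [/\ C u, forall x, sval u x <= sval s x &
          forall x, sval u x <= sval t x].
        by case: (totC s t Cs Ct) => /asboolP H; [exists t|exists s].
      have := sublinearD (svalP u).1 x y; have := qle u (x + y) Cu.
      have := us y; have := ut x; lra.
    apply/eqP; rewrite eq_le; apply/andP; split.
      have [->|an0] := eqVneq a 0.
        by rewrite mul0r scale0r -(sublinear0 (svalP c0).1); exact: qle.
      have ap : 0 < a by rewrite lt_neqAle eq_sym an0.
      rewrite -ler_pdivrMl//; apply: (le_q _ _) => s Cs; rewrite ler_pdivrMl//.
      by rewrite -(sublinearZ (svalP s).1 _ a0); exact: qle.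
    apply: (le_q _ _) => s Cs; rewrite (sublinearZ (svalP s).1)//.
    by rewrite ler_wpM2l//; exact: qle.
  have qp x : q x <= p x by apply: le_trans (qle c0 x Cc0) ((svalP c0).2 x).
  by exists (exist _ q (conj sq qp)) => s Cs; apply/asboolP => x; exact: qle.
exists q; split=> // q' sq' q'q.
have Pq' : sublinear q' /\ forall x, q' x <= p x.
  by split=> // x; exact: le_trans (q'q x) (qp x).
have := qmin (exist _ q' Pq'); rewrite /r /= => /(_ (asboolT q'q)).
by move=> /(congr1 sval).
Qed.

(** A minimal sublinear [f] equals all its [ray_reduce f z], which makes it additive. Starting from
    [ray_reduce p y] gives [f (- y) <= - p y], so the value [p y] is attained. *)
Lemma sublinear_minorant p y : sublinear p -> exists f : V -> R,
  [/\ forall (a : R) x z, f (a *: x + z) = a * f x + f z, forall x, f x <= p x & f y = p y].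
Proof.
move=> sp; have [f [sf fp fmin]] := sublinear_minimal (ray_reduce_sublinear y sp).
have fD x z : f (x + z) = f x + f z.
  apply/eqP; rewrite eq_le (sublinearD sf)/=.
  have <- : ray_reduce f z = f.
    by apply: fmin; [exact: ray_reduce_sublinear|move=> u; exact: ray_reduce_le_self].
  have E : ray_reduce f z = f.
    by apply: fmin; [exact: ray_reduce_sublinear|move=> u; exact: ray_reduce_le_self].
  by have := ray_reduce_le x z sf ler01; rewrite E scale1r mul1r; lra.
have fN x : f (- x) = - f x.
  by have := fD x (- x); rewrite subrr (sublinear0 sf); lra.
exists f; split=> [a x z|x|].
- rewrite fD; congr (_ + _); have [a0|a0] := leP 0 a; first exact: sublinearZ.
  by rewrite -[a]opprK scaleNr fN (sublinearZ sf) ?mulNr// oppr_ge0 ltW.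
- by apply: le_trans (fp x) _; exact: ray_reduce_le_self.
- apply/eqP; rewrite eq_le (le_trans (fp y) (ray_reduce_le_self y y sp))/=.
  have := fp (- y); have := ray_reduce_le (- y) y sp ler01.
  by rewrite scale1r addNr (sublinear0 sp) fN; lra.
Qed.

End hahn_banach.


(** * Dual norms with closed ball *)

Lemma compact_initial (S : choiceType) (T : topologicalType) (f : S -> T)
    (A : set (initial_topology f)) :
  compact (f @` A) -> compact A.
Proof.
move=> kA F FF FA.
have [_ [[x Ax <-] clx]] : (f @` A) `&` cluster (f @ F) !=set0.
  apply: kA; change (F (f @^-1` (f @` A))).
  by apply: (filterS _ FA) => y Ay; exists y.
exists x; split=> // P Q FP [_ [[W oW <-] Wx WQ]].
have [||_ [[z Pz <-] Wz]] := clx (f @` P) W.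
- change (F (f @^-1` (f @` P))).
  by apply: (filterS _ FP) => y Py; exists y.
- exact: open_nbhs_nbhs.
- by exists z; split=> //; exact: WQ.
Qed.

Section box.
Context {R : realType} {I : eqType}.
Local Notation P := (prod_topology (fun _ : I => R)).

Lemma compact_box (b : I -> R) : compact [set f : P | forall i, `|f i| <= b i].
Proof.
have := @tychonoff I (fun=> R) (fun i => [set x | `|x| <= b i]).
apply=> i; rewrite (_ : [set _ | _] = `[- b i, b i]%classic).
  exact: segment_compact.
by apply/seteqP; split=> x /=; rewrite in_itv /= ler_norml.
Qed.

Lemma eval_prod_continuous (i : I) : continuous (fun f : P => f i).
Proof. exact: (@proj_continuous I (fun=> R) i). Qed.

End box.

Section dual_facts.
Context {R : realType} {X : normedModType R}.
Implicit Types f g : dual X.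

Lemma dual_of_bounded (f : X -> R) (C : R) :
  (forall (a : R) x y, f (a *: x + y) = a * f x + f y) ->
  (forall x, `|f x| <= C * `|x|) -> exists g : dual X, forall x, g x = f x.
Proof.
move=> lf fC.
have lf' : linear (f : X -> R^o) by move=> a x y; exact: lf.
pose F : {linear X -> R^o} := HB.pack (f : X -> R^o) (GRing.isLinear.Build _ _ _ _ _ lf').
have cf : continuous (f : X -> R^o).
  apply: (@bounded_linear_continuous R X R^o F); apply/linear_boundedP.
  exists C; split; first exact: num_real.
  by move=> r Cr x; apply: le_trans (fC x) _; rewrite ler_wpM2r// ltW.
have Ff : (f : X -> R^o) \in @continuous_linear R X by apply/asboolP.
by exists (Dual Ff).
Qed.

Lemma dual_le_norm f x : `|f x| <= `|f| * `|x|.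
Proof.
have [->|x0] := eqVneq x 0; first by rewrite linear0 !normr0 mulr0.
have nx : 0 < `|x| by rewrite normr_gt0.
rewrite -ler_pdivrMr// mulrC.
have -> : `|x|^-1 * `|f x| = `|f (`|x|^-1 *: x)|.
  by rewrite linearZ /= normrM normfV normr_id.
rewrite dual_normE; apply: ub_le_sup; last first.
  exists (`|x|^-1 *: x) => //=.
  by rewrite normrZ normfV normr_id mulVf// gt_eqF.
have /linear_boundedP/pinfty_ex_gt0[M M0 fM] :=
  continuous_linear_bounded 0 (@dual_continuous _ _ f 0).
exists M => _ [y /= y1 <-]; apply: le_trans (fM y) _.
by rewrite ler_piMr // ltW.
Qed.

Lemma dual_norm_le f c : (forall x, `|x| <= 1 -> `|f x| <= c) -> `|f| <= c.
Proof.
move=> fc; rewrite dual_normE; apply: ge_sup.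
  by exists `|f 0|, 0 => //=; rewrite normr0.
by move=> _ [x /= x1 <-]; exact: fc.
Qed.

Lemma dual_ext f g : (forall x, f x = g x) -> f = g.
Proof. by move=> fg; apply/val_inj/funext. Qed.

Lemma norming_functional (x : X) : exists f, `|f| <= 1 /\ f x = `|x|.
Proof.
have sn : sublinear (fun y : X => `|y|).
  split=> [y z|a y a0]; first exact: ler_normD.
  by rewrite normrZ ger0_norm.
have [f [lf fle fx]] := sublinear_minorant x sn.
have f0 : f 0 = 0.
  by have := lf 1 0 0; rewrite scale1r addr0 mul1r; lra.
have fN y : f (- y) = - f y.
  by have := lf (-1) y 0; rewrite scaleN1r !addr0 f0 addr0 mulN1r.
have fabs y : `|f y| <= 1 * `|y|.
  rewrite mul1r ler_norml fle andbT.
  by have := fle (- y); rewrite fN normrN; lra.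
have [g gf] := dual_of_bounded lf fabs.
exists g; split; last by rewrite gf.
by apply: dual_norm_le => y y1; rewrite gf; apply: le_trans (fabs y) _; rewrite mul1r.
Qed.

Lemma weak_star_eval_continuous (x : X) :
  continuous (fun f : weak_star X => (f : dual X) x : R).
Proof.
move=> f.
apply: (@continuous_comp (weak_star X) (prod_topology (fun _ : X => R)) R
  (fun h : dual X => (h : X -> R)) (fun h => h x)).
  exact: (@initial_continuous (dual X) {ptws X -> R^o}
    (fun h : dual X => (h : X -> R^o) : {ptws X -> R^o})).
exact: eval_prod_continuous.
Qed.

Lemma weak_star_hausdorff : hausdorff_space (weak_star X).
Proof.
move=> f g cl; apply: dual_ext => x.
have hR : hausdorff_space R by exact: norm_hausdorff.
apply: hR => A B nA nB.
have := cl _ _ (weak_star_eval_continuous nA) (weak_star_eval_continuous nB).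
by move=> [h [Ah Bh]]; exists ((h : dual X) x).
Qed.

(** In the product space the ball is the part of a compact box cut out by the closed conditions of
    linearity. *)
Lemma alaoglu (r : R) : 0 <= r -> compact [set f : weak_star X | `|(f : dual X)| <= r].
Proof.
move=> r0; apply: compact_initial.
pose E : set (prod_topology (fun _ : X => R)) :=
  (fun f : dual X => f : X -> R) @` [set f : dual X | `|f| <= r].
suff : compact E by exact.
refine (@subclosed_compact (prod_topology (fun _ : X => R)) E _ _
  (@compact_box R X (fun x : X => r * `|x|)) _); last first.
  move=> _ [f /= fr <-] x; apply: le_trans (dual_le_norm f x) _.
  by rewrite ler_wpM2r.
pose P := prod_topology (fun _ : X => R).
rewrite (_ : E = [set h : P | forall x, `|h x| <= r * `|x|] `&`
  \bigcap_(u in [set: R * X * X])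
    [set h : P | h (u.1.1 *: u.1.2 + u.2) - (u.1.1 * h u.1.2 + h u.2) <= 0] `&`
  \bigcap_(u in [set: R * X * X])
    [set h : P | 0 <= h (u.1.1 *: u.1.2 + u.2) - (u.1.1 * h u.1.2 + h u.2)]).
  have cont (u : R * X * X) : continuous (fun h : P =>
      h (u.1.1 *: u.1.2 + u.2) - (u.1.1 * h u.1.2 + h u.2)).
    move=> h; apply: (@continuousB R R P (fun h => h (u.1.1 *: u.1.2 + u.2))
      (fun h => u.1.1 * h u.1.2 + h u.2)); first exact: eval_prod_continuous.
    exact: (@continuous_affine R P u.1.1 (fun h : P => h u.1.2) (fun h => h u.2)
      (@eval_prod_continuous R X _) (@eval_prod_continuous R X _) h).
  apply: closedI; first apply: closedI.
  - apply: compact_closed; last exact: (@compact_box R X).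
    by apply: (@hausdorff_product X (fun=> R)) => _; exact: norm_hausdorff.
  - apply: closed_bigI => u _.
    apply: (@preimage_closed _ _ _ [set y : R | y <= 0]); last exact: closed_le.
    by move=> h _; exact: cont.
  - apply: closed_bigI => u _.
    apply: (@preimage_closed _ _ _ [set y : R | 0 <= y]); last exact: closed_ge.
    by move=> h _; exact: cont.
apply/seteqP; split=> [_ [f /= fr <-]|h [[/= hr h1] h2]].
  split; [split|] => [x|u _ /=|u _ /=].
  - by apply: le_trans (dual_le_norm f x) _; rewrite ler_wpM2r.
  - by rewrite linearP subrr.
  - by rewrite linearP subrr.
have lh (a : R) x y : h (a *: x + y) = a * h x + h y.
  have := h1 (a, x, y) Logic.I; have := h2 (a, x, y) Logic.I; rewrite /=; lra.
have [g gh] := dual_of_bounded lh hr.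
exists g; last exact/funext.
apply: dual_norm_le => x x1; rewrite gh; apply: le_trans (hr x) _.
by rewrite ler_piMr.
Qed.

End dual_facts.


(** * The predual norm of a weak-star closed ball *)

Section predual.
Context {R : realType} {X : normedModType R} (q : dual X -> R) (D : R).
Hypothesis qD : forall f g, q (f + g) <= q f + q g.
Hypothesis qZ : forall (a : R) f, q (a *: f) = `|a| * q f.
Hypothesis q_ge : forall f, `|f| <= q f.
Hypothesis D_gt0 : 0 < D.
Hypothesis q_le : forall f, q f <= D * `|f|.
Let B : set (weak_star X) := [set f | q f <= 1].
Hypothesis B_closed : closed B.

Let B_compact : compact B.
Proof.
refine (@subclosed_compact (weak_star X) B _ B_closed (alaoglu ler01) _).
by move=> f /=; exact: le_trans (q_ge f).
Qed.

Definition predual_norm (x : X) : R := sup [set (f : dual X) x | f in [set f | q f <= 1]].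

Let q0 : q 0 = 0.
Proof. by rewrite -(scale0r (0 : dual X)) qZ normr0 mul0r. Qed.

Let q_ge0 f : 0 <= q f. Proof. exact: le_trans (q_ge f). Qed.

Lemma predual_norm_ub f x : q f <= 1 -> f x <= predual_norm x.
Proof.
move=> qf; apply: ub_le_sup; last by exists f.
exists `|x| => _ [g /= qg <-]; apply: le_trans (ler_norm _) _.
apply: le_trans (dual_le_norm g x) _; rewrite ler_piMl//.
exact: le_trans (q_ge g) qg.
Qed.

Lemma predual_norm_le x c : (forall f, q f <= 1 -> f x <= c) -> predual_norm x <= c.
Proof.
move=> fc; apply: ge_sup; last by move=> _ [f /= qf <-]; exact: fc.
by exists ((0 : dual X) x), 0 => //=; rewrite q0.
Qed.

Lemma predual_norm_le_norm x : predual_norm x <= `|x|.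
Proof.
apply: predual_norm_le => f qf; apply: le_trans (ler_norm _) _.
by apply: le_trans (dual_le_norm f x) _; rewrite ler_piMl// (le_trans (q_ge f)).
Qed.

Lemma norm_le_predual_norm x : `|x| <= D * predual_norm x.
Proof.
have [f [f1 fx]] := norming_functional x.
rewrite -fx -ler_pdivrMl//.
have -> : D^-1 * f x = (D^-1 *: f : dual X) x by [].
apply: predual_norm_ub; rewrite qZ gtr0_norm ?invr_gt0// ler_pdivrMl// mulr1.
by apply: le_trans (q_le f) _; rewrite ler_piMr// ltW.
Qed.

(* By compactness finitely many points of [X] already separate [f0] from the ball,
   which reduces the separation to a nearest point argument in finite dimension. *)
Lemma predual_norm_separation f0 : 1 < q f0 -> exists z, predual_norm z < f0 z.
Proof.
move=> qf0.
pose V x : set (weak_star X) := [set f | (f : dual X) x != f0 x].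
have oV x : setT x -> open (V x).
  move=> _; apply: (@open_comp (weak_star X) R (fun f : weak_star X => (f : dual X) x)
    [set y | y != f0 x]).
    by move=> f _; exact: weak_star_eval_continuous.
  exact: open_neq.
have [|s [_ sB]] := compact_finite_cover B_compact oV.
  move=> f Bf; apply: contrapT => nV.
  suff E : (f : dual X) = f0 by move: Bf; rewrite /B /= E leNgt qf0.
  apply: dual_ext => x; apply: contrapT => fx; apply: nV; exists x => //.
  exact/eqP.
pose G (f : dual X) := \sum_(x <- s) (f x - f0 x) ^+ 2.
have cG : sublevel_closed B (G : weak_star X -> R).
  have cont (s' : seq X) : continuous (fun f : weak_star X =>
      \sum_(x <- s') ((f : dual X) x - f0 x) ^+ 2 : R).
    elim: s' => [|x s' IH].
      rewrite (_ : (fun f : weak_star X => _) = fun=> 0); first exact: cst_continuousR.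
      by apply/funext => g; rewrite big_nil.
    rewrite (_ : (fun f : weak_star X => _) = fun g : dual X =>
        1 * ((g x - f0 x) * (g x - f0 x)) + \sum_(y <- s') (g y - f0 y) ^+ 2); last first.
      by apply/funext => g; rewrite big_cons expr2 mul1r.
    have c1 : continuous (fun g : weak_star X => (g : dual X) x - f0 x).
      move=> f; apply: (@continuousB R R (weak_star X) (fun g : weak_star X => (g : dual X) x)
        (fun=> f0 x)); [exact: weak_star_eval_continuous|exact: cst_continuousR].
    exact: (@continuous_affine R (weak_star X) 1 _ _ (continuous_mul c1 c1) IH).
  move=> c; apply: closedI => //.
  apply: (@preimage_closed _ _ _ [set y : R | y <= c]); last exact: closed_le.
  by move=> f _; exact: (cont s).
have B0 : B (0 : dual X) by rewrite /B /= q0.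
have [f1 Bf1 f1min] := sublevel_closed_min B_compact B0 cG.
(* The direction from the nearest point [f1] to [f0], read as an element of [X]. *)
pose z := \sum_(x <- s) (f0 x - (f1 : dual X) x) *: x.
have fz (f : dual X) : f z = \sum_(x <- s) (f0 x - (f1 : dual X) x) * f x.
  by rewrite /z linear_sum; apply: eq_bigr => x _; rewrite linearZ.
have G1 : 0 < G f1.
  have [x xs /eqP fx] := sB f1 Bf1.
  rewrite lt_neqAle; apply/andP; split; last by apply: sumr_ge0 => y _; exact: sqr_ge0.
  apply/eqP => /esym/eqP; rewrite /G big_seq psumr_eq0 => [/allP/(_ x xs)|y _]; last exact: sqr_ge0.
  by rewrite xs sqrf_eq0 subr_eq0 => /eqP.
have fle (f : dual X) : q f <= 1 -> f z <= (f1 : dual X) z.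
  move=> qf; rewrite leNgt; apply/negP => lt.
  pose a := f z - (f1 : dual X) z; have a0 : 0 < a by rewrite subr_gt0.
  pose b := \sum_(x <- s) (f x - (f1 : dual X) x) ^+ 2.
  have b0 : 0 <= b by apply: sumr_ge0 => x _; exact: sqr_ge0.
  (* The change of [G] along the segment from [f1] to [f], which stays in the ball. *)
  have H (t : R) : 0 <= t <= 1 -> 0 <= t ^+ 2 * b - 2 * t * a.
    move=> /andP[t0 t1].
    have := f1min ((1 - t) *: (f1 : dual X) + t *: f) _.
    have Bt : B ((1 - t) *: (f1 : dual X) + t *: f).
      rewrite /B /=; apply: le_trans (qD _ _) _; rewrite !qZ !ger0_norm ?subr_ge0//.
      move: Bf1; rewrite /B /= => q1.
      have := ler_wpM2l t0 qf; have : 0 <= 1 - t by lra.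
      by move=> /ler_wpM2l/(_ _ _ q1); lra.
    move=> /(_ Bt); suff -> : G ((1 - t) *: (f1 : dual X) + t *: f) =
        G f1 + (t ^+ 2 * b - 2 * t * a) by lra.
    have -> : G ((1 - t) *: (f1 : dual X) + t *: f) =
      \sum_(x <- s) ((1 - t) * (f1 : dual X) x + t * f x - f0 x) ^+ 2 by [].
    rewrite /G /b /a !fz -sumrB !mulr_sumr -sumrB -big_split /=.
    apply: eq_bigr => x _.
    ring.
  (* The quadratic is least at [t = a / b]; if that exceeds 1, the end [t = 1] is already
     negative. *)
  have [ab|ba] := leP b a.
    by have := H 1; rewrite ler01 lexx expr1n => /(_ isT); lra.
  have bp : 0 < b by lra.
  have := H (a / b); rewrite divr_ge0//; last lra.
  rewrite ler_pdivrMr// mul1r (ltW ba) => /(_ isT).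
  have -> : (a / b) ^+ 2 * b - 2 * (a / b) * a = - (a ^+ 2 / b) by field; rewrite gt_eqF.
  by rewrite oppr_ge0 leNgt divr_gt0// exprn_gt0.
exists z; apply: (@le_lt_trans _ _ ((f1 : dual X) z)).
  by apply: predual_norm_le => f; exact: fle.
rewrite -subr_gt0 !fz -sumrB; suff -> : \sum_(x <- s) ((f0 x - (f1 : dual X) x) * f0 x -
  (f0 x - (f1 : dual X) x) * (f1 : dual X) x) = G f1 by [].
by apply: eq_bigr => x _; ring.
Qed.

Lemma predual_norm_is_norm : is_norm predual_norm.
Proof.
have Zle (a : R) x : predual_norm (a *: x) <= `|a| * predual_norm x.
  apply: predual_norm_le => f qf.
  have -> : f (a *: x) = a * f x by rewrite linearZ.
  have [a0|a0] := leP 0 a.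
    by rewrite ger0_norm// ler_wpM2l// predual_norm_ub.
  rewrite ltr0_norm// -[a * f x]mulrNN ler_wpM2l ?oppr_ge0 ?(ltW a0)//.
  have -> : - f x = (- f : dual X) x by [].
  by apply: predual_norm_ub; rewrite -scaleN1r qZ normrN1 mul1r.
split=> [x y|a x|x px].
- apply: predual_norm_le => f qf; rewrite linearD.
  by rewrite lerD// predual_norm_ub.
- apply/eqP; rewrite eq_le Zle/=; have [->|a0] := eqVneq a 0.
    rewrite normr0 mul0r; have := @predual_norm_ub 0 (0 *: x).
    by rewrite q0 => /(_ ler01).
  rewrite -ler_pdivlMl ?normr_gt0//; have := Zle a^-1 (a *: x).
  by rewrite scalerA mulVf// scale1r normfV.
- apply/eqP; rewrite -normr_le0; have := norm_le_predual_norm x.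
  by rewrite px mulr0.
Qed.

(** If the dual norm [c] of [f] were less than [q f], then for [d] between them [f / d] would lie
    outside the ball; normalising the [z] that separates it gives a unit vector where [|f|] exceeds
    [d]. *)
Lemma equivalent_dual_norm_of_closed_ball : equivalent_dual_norm q.
Proof.
have [pD pZ p0] := predual_norm_is_norm.
have p_ge0 x : 0 <= predual_norm x.
  by have := @predual_norm_ub 0 x; rewrite q0 => /(_ ler01).
exists predual_norm; split.
- exact: predual_norm_is_norm.
- split; first by exists 1 => x; rewrite mul1r; exact: predual_norm_le_norm.
  by exists D => x; exact: norm_le_predual_norm.
apply/funext => f.
have ub x : predual_norm x <= 1 -> `|f x| <= q f.
  move=> px; have [qf0|qf0] := leP (q f) 0.
    apply: le_trans (dual_le_norm f x) _.
    have -> : `|f| = 0 by apply/eqP; rewrite eq_le normr_ge0 (le_trans (q_ge f)).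
    by rewrite mul0r.
  have H g : q g <= q f -> g x <= q f.
    move=> gf; have := @predual_norm_ub ((q f)^-1 *: g) x.
    rewrite qZ gtr0_norm ?invr_gt0// ler_pdivrMl// mulr1 => /(_ gf).
    have -> : ((q f)^-1 *: g : dual X) x = (q f)^-1 * g x by [].
    by rewrite ler_pdivrMl// => /le_trans; apply; rewrite ler_piMr.
  rewrite ler_norml H// andbT lerNl.
  have -> : - f x = (- f : dual X) x by [].
  by apply: H; rewrite -scaleN1r qZ normrN1 mul1r.
apply/eqP; rewrite eq_le; apply/andP; split; last first.
  apply: ge_sup; last by move=> _ [x /= px <-]; exact: ub.
  by exists `|f 0|, 0 => //=; rewrite -(scale0r (0 : X)) pZ normr0 mul0r.
rewrite leNgt; apply/negP => lt.
set c := dual_norm predual_norm f in lt.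
have dub x : predual_norm x <= 1 -> `|f x| <= c.
  move=> px; apply: ub_le_sup; last by exists x.
  by exists (q f) => _ [y /= py <-]; exact: ub.
have c0 : 0 <= c.
  by apply: le_trans (dub 0 _); rewrite ?normr_ge0// -(scale0r (0 : X)) pZ normr0 mul0r.
pose d := (c + q f) / 2; have d0 : 0 < d by rewrite /d; lra.
have [|z] := @predual_norm_separation (d^-1 *: f).
  by rewrite qZ gtr0_norm ?invr_gt0// ltr_pdivlMl// mulr1 /d; lra.
have -> : (d^-1 *: f : dual X) z = d^-1 * f z by [].
rewrite ltr_pdivlMl// => fz.
have [pz|pz] := leP (predual_norm z) 0.
  have z0 : z = 0 by apply: p0; apply/eqP; rewrite eq_le pz p_ge0.
  move: fz; rewrite z0 linear0 -{1}(scale0r (0 : X)) pZ normr0 mul0r mulr0.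
  by rewrite ltxx.
have := dub ((predual_norm z)^-1 *: z).
rewrite pZ gtr0_norm ?invr_gt0// mulVf ?gt_eqF// => /(_ (lexx _)).
rewrite linearZ /= normrM gtr0_norm ?invr_gt0// ler_pdivrMl// leNgt => /negP; apply.
apply: lt_le_trans (ler_norm _); apply: le_lt_trans fz; rewrite mulrC.
by rewrite ler_wpM2r ?(ltW pz)// /d; lra.
Qed.

End predual.


(** * The renorming *)

Lemma continuous_to_prod (Z : topologicalType) (R : realType) (I : choiceType)
    (F : Z -> prod_topology (fun _ : I => R)) :
  (forall i, continuous (fun z => F z i)) -> continuous F.
Proof.
move=> cF z; apply/cvg_sup => i A [_ [[W oW <-] Wz WA]].
have : nbhs z (F @^-1` (@^~ i @^-1` W)).
  by apply: (cF i z); exact: open_nbhs_nbhs.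
by apply: filterS => y /= Wy; exact: WA.
Qed.

(** * Weak-star compactness of bounded functionals *)

Section functional_space.
Context {R : realType} {T : topologicalType}.
Hypothesis cT : compact [set: T].
Local Notation P := (prod_topology (fun _ : (T -> R) => R)).

Lemma bounded_functionalS (r s : R) (m : (T -> R) -> R) : r <= s ->
  bounded_functional r m -> bounded_functional s m.
Proof.
move=> rs bm; split; [exact: bfun_lin bm| |exact: bfun_junk bm].
by move=> g cg g1; apply: le_trans (bfun_le bm cg g1) rs.
Qed.

Lemma bounded_functional_nrm (r : R) (m : (T -> R) -> R) :
  bounded_functional r m -> bounded_functional (variation m setT) m.
Proof.
move=> bm; split; [exact: bfun_lin bm| |exact: bfun_junk bm].
move=> g cg g1; have tg : test setT g by split=> // t /(_ Logic.I).
have cN : continuous (fun t => -1 * g t).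
  by apply: continuous_mul => //; exact: cst_continuousR.
have tN : test setT (fun t => -1 * g t).
  by split=> // t; [rewrite mulN1r normrN|move=> /(_ Logic.I)].
have := variation_ub bm tg; have := variation_ub bm tN.
by rewrite (bfunZ bm)// ler_norml; lra.
Qed.

(** Every coordinate is bounded: at a continuous [g] by [r] times a bound of [g], at a discontinuous
    one by the junk value 0. The defining conditions are closed in the resulting box. *)
Lemma bounded_functional_compact (r : R) :
  compact [set m : P | bounded_functional r m].
Proof.
have /choice[b bP] (g : T -> R) : exists b, forall m,
    bounded_functional r m -> `|m g| <= b.
  have [cg|ncg] := pselect (continuous g); last first.
    by exists 0 => m bm; rewrite (bfun_junk bm)// normr0.
  have [c c0 gc] := compact_bounded_fun cT cg.
  by exists (r * c) => m bm; exact: (bfun_le_scale bm (ltW c0) cg gc).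
refine (@subclosed_compact P _ _ _ (@compact_box R (T -> R) b) _); last first.
  by move=> m bm g; exact: bP.
pose L := [set u : R * (T -> R) * (T -> R) | continuous u.1.2 /\ continuous u.2].
pose N := [set g : T -> R | continuous g /\ forall t, `|g t| <= 1].
pose J := [set g : T -> R | ~ continuous g].
pose lin (u : R * (T -> R) * (T -> R)) (m : P) :=
  m (fun t => u.1.1 * u.1.2 t + u.2 t) - (u.1.1 * m u.1.2 + m u.2).
rewrite (_ : [set m : P | bounded_functional r m] =
  (\bigcap_(u in L) [set m | lin u m = 0] `&`
   \bigcap_(g in N) [set m : P | `|m g| <= r]) `&`
   \bigcap_(g in J) [set m : P | m g = 0]).
  have cP g : continuous (fun m : P => m g) := @eval_prod_continuous R (T -> R) g.
  have closed1 (x : R) : closed [set y : R | y = x].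
    exact: closed_eq.
  apply: closedI; first apply: closedI.
  - apply: closed_bigI => u _.
    apply: (@preimage_closed P R (lin u) [set y | y = 0]) => // m _.
    apply: (@continuousB R R P (fun m => m (fun t => u.1.1 * u.1.2 t + u.2 t))
      (fun m => u.1.1 * m u.1.2 + m u.2)); first exact: cP.
    exact: (@continuous_affine R P u.1.1 (fun m : P => m u.1.2) (fun m => m u.2)
      (cP _) (cP _) m).
  - apply: closed_bigI => g _.
    apply: (@preimage_closed P R (fun m => `|m g|) [set y | y <= r]); last exact: closed_le.
    move=> m _; apply: (@continuous_comp _ _ _ (fun m : P => m g) (fun y : R => `|y|)).
      exact: cP.
    exact: norm_continuous.
  - apply: closed_bigI => g _.
    by apply: (@preimage_closed P R (fun m => m g) [set y | y = 0]) => // m _; exact: cP.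
apply/seteqP; split=> [m bm|m [[mL mN] mJ]].
  split; [split|].
  - by move=> u [c1 c2]; rewrite /= /lin (bfun_lin bm)// subrr.
  - by move=> g [cg g1]; have := bfun_le bm cg g1.
  - by move=> g ncg; have := bfun_junk bm ncg.
split=> [a g h cg ch|g cg g1|g ncg].
- by apply/eqP; rewrite -subr_eq0; apply/eqP; exact: (mL (a, g, h)).
- exact: mN.
- exact: mJ.
Qed.

Lemma functional_hausdorff : hausdorff_space P.
Proof. by apply: (@hausdorff_product (T -> R) (fun=> R)) => _; exact: norm_hausdorff. Qed.

Lemma bounded_functional_closed (r : R) :
  closed [set m : P | bounded_functional r m].
Proof. by apply: (compact_closed functional_hausdorff); exact: bounded_functional_compact. Qed.

End functional_space.


Section norm_facts.
Context {R : realType} {V : lmodType R} (p : V -> R).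
Hypothesis p_norm : is_norm p.

Lemma is_normN x : p (- x) = p x.
Proof. by rewrite -scaleN1r (is_normZ p_norm) normrN1 mul1r. Qed.

Lemma is_norm0 : p 0 = 0.
Proof. by rewrite -(scale0r (0 : V)) (is_normZ p_norm) normr0 mul0r. Qed.

Lemma is_norm_ge0 x : 0 <= p x.
Proof. by have := is_normD p_norm x (- x); rewrite subrr is_norm0 is_normN; lra. Qed.

End norm_facts.

(** At [t = a / (a + b)], the minimiser, the bound is exactly [(a + b)^2]. *)
Lemma sqr_sum_le (R : realFieldType) (a b c : R) : 0 < a -> 0 < b ->
  (forall t, 0 < t < 1 -> c <= t^-1 * a ^+ 2 + (1 - t)^-1 * b ^+ 2) ->
  c <= (a + b) ^+ 2.
Proof.
move=> a0 b0 cab; have s0 : 0 < a + b by rewrite addr_gt0.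
have t01 : 0 < a / (a + b) < 1.
  by rewrite divr_gt0//= ltr_pdivrMr// mul1r ltrDl.
apply: le_trans (cab _ t01) _; rewrite le_eqVlt; apply/orP; left; apply/eqP.
field; rewrite ?gt_eqF//=; lra.
Qed.

(** * Dual norms as square roots of convex 2-homogeneous functions *)

Section sqrt_norm.
Context {R : realType} {X : normedModType R} (Phi : dual X -> R) (D : R).
Hypothesis Phi_add : forall f g (t : R), 0 < t < 1 ->
  Phi (f + g) <= t^-1 * Phi f + (1 - t)^-1 * Phi g.
Hypothesis Phi_scale : forall (a : R) f, Phi (a *: f) = a ^+ 2 * Phi f.
Hypothesis Phi_ge : forall f, `|f| ^+ 2 <= Phi f.
Hypothesis Phi_le : forall f, Phi f <= (1 + D ^+ 2) * `|f| ^+ 2.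
Hypothesis Phi_closed : closed [set f : weak_star X | Phi (f : dual X) <= 1].
Implicit Types f g : dual X.

Definition sqrt_norm f : R := Num.sqrt (Phi f).

Let Phi_ge0 f : 0 <= Phi f.
Proof. by apply: le_trans (Phi_ge f); exact: sqr_ge0. Qed.

Let sqrt_norm_sqr f : Phi f = sqrt_norm f ^+ 2.
Proof. by rewrite sqr_sqrtr. Qed.

Let sqrt_norm_ge f : `|f| <= sqrt_norm f.
Proof. by rewrite -(ger0_norm (normr_ge0 f)) -sqrtr_sqr ler_wsqrtr// Phi_ge. Qed.

Let sqrt_normZ (a : R) f : sqrt_norm (a *: f) = `|a| * sqrt_norm f.
Proof. by rewrite /sqrt_norm Phi_scale sqrtrM ?sqr_ge0// sqrtr_sqr. Qed.

Let sqrt_normD f g : sqrt_norm (f + g) <= sqrt_norm f + sqrt_norm g.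
Proof.
have zero h : sqrt_norm h = 0 -> h = 0.
  by move=> h0; apply/eqP; rewrite -normr_le0 -h0 sqrt_norm_ge.
have [f0|f0] := pselect (sqrt_norm f = 0).
  by rewrite (zero f f0) add0r lerDr sqrtr_ge0.
have [g0|g0] := pselect (sqrt_norm g = 0).
  by rewrite (zero g g0) addr0 lerDl sqrtr_ge0.
have pos h : sqrt_norm h <> 0 -> 0 < sqrt_norm h.
  by move=> /eqP h0; rewrite lt_neqAle eq_sym h0 sqrtr_ge0.
have {}f0 := pos f f0; have {}g0 := pos g g0.
have : Phi (f + g) <= (sqrt_norm f + sqrt_norm g) ^+ 2.
  by apply: sqr_sum_le => // t t01; rewrite -!sqrt_norm_sqr; exact: Phi_add.
move=> /ler_wsqrtr le; apply: le_trans le _.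
by rewrite sqrtr_sqr ger0_norm// addr_ge0// ltW.
Qed.

Lemma sqrt_norm_equivalent_dual_norm : equivalent_dual_norm sqrt_norm.
Proof.
apply: (@equivalent_dual_norm_of_closed_ball R X sqrt_norm (1 + D ^+ 2)).
- exact: sqrt_normD.
- exact: sqrt_normZ.
- exact: sqrt_norm_ge.
- by rewrite ltr_wpDr// sqr_ge0.
- move=> f; have D1 : 1 <= 1 + D ^+ 2 by rewrite lerDl sqr_ge0.
  have D0 : 0 <= 1 + D ^+ 2 by lra.
  rewrite -(ger0_norm (mulr_ge0 D0 (normr_ge0 f))) -sqrtr_sqr ler_wsqrtr//.
  apply: le_trans (Phi_le f) _; rewrite exprMn ler_wpM2r ?sqr_ge0//.
  by rewrite expr2 ler_peMr.
- rewrite (_ : [set f | _] = [set f : weak_star X | Phi (f : dual X) <= 1]) //.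
  have E f : (sqrt_norm f <= 1) = (Phi f <= 1).
    by rewrite sqrt_norm_sqr -[in RHS](expr1n _ 2) ler_sqr ?nnegrE ?sqrtr_ge0.
  by apply/seteqP; split=> f /=; rewrite E.
Qed.

Lemma sqrt_norm_midpoint f g : sqrt_norm f = sqrt_norm g ->
  sqrt_norm g = 2^-1 * sqrt_norm (f + g) -> Phi (f + g) = 2 * Phi f + 2 * Phi g.
Proof.
move=> fg gfg; have E : sqrt_norm (f + g) = 2 * sqrt_norm g.
  by rewrite gfg mulrA mulfV// mul1r.
by rewrite !sqrt_norm_sqr E fg; ring.
Qed.

End sqrt_norm.

(** * The penalised approximation and the resulting norm *)

Section renorming.
Context {R : realType} {X : normedModType R} {T : topologicalType}.
Hypothesis cT : compact [set: T].
Context (ev : X -> T -> R) (Cev : R).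
Hypothesis ev_continuous : forall x, continuous (ev x).
Hypothesis ev_linear : forall (a : R) x y t, ev (a *: x + y) t = a * ev x t + ev y t.
Hypothesis Cev_ge0 : 0 <= Cev.
Hypothesis ev_le : forall x t, `|ev x t| <= Cev * `|x|.

(** The Gruenhage property enters this section only through [H_rigid]; [H0] puts the total variation
    among the seminorms, so that the energy controls it. *)
Context (H : nat -> set (T -> R)).
Hypothesis H0 : H 0%N = test setT.
Hypothesis H_test : forall j, H j `<=` test setT.
Hypothesis H_nonempty : forall j, H j !=set0.
Hypothesis H_sym : forall j h, H j h -> H j (fun t => -1 * h t).
Hypothesis H_rigid : forall r s m n, bounded_functional r m -> bounded_functional s n ->
  (forall j, support_fun (H j) m = support_fun (H j) n) ->
  (forall j, support_fun (H j) (fun h => m h + n h) =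
    support_fun (H j) m + support_fun (H j) n) ->
  forall h, continuous h -> m h = n h.

Context (M : dual X -> R) (CM : R).
Hypothesis M_norm : is_norm M.
Hypothesis M_le : forall f, M f <= CM * `|f|.
Hypothesis M_lsc : weak_star_lsc M.

Implicit Types (f g : dual X) (m n : (T -> R) -> R).
Local Notation P := (prod_topology (fun _ : (T -> R) => R)).

(* The adjoint of [ev : X -> C(T)]; meaningful for bounded functionals only. *)
Definition adj m : dual X := xget 0 [set f : dual X | forall x, f x = m (ev x)].

Lemma adjE r m x : bounded_functional r m -> adj m x = m (ev x).
Proof.
move=> bm; have [f fE] : exists f : dual X, forall x, f x = m (ev x).
  apply: (@dual_of_bounded R X (fun x => m (ev x)) (r * Cev)) => [a y z|y].
    by rewrite -(bfun_lin bm)//; congr m; apply/funext => t; exact: ev_linear.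
  rewrite -mulrA; apply: (bfun_le_scale bm); first by rewrite mulr_ge0.
    exact: ev_continuous.
  exact: ev_le.
by rewrite /adj; case: xgetP => [g _ /= ->//|/(_ f)]; case.
Qed.

Lemma adjD r s m n : bounded_functional r m -> bounded_functional s n ->
  adj (fun h => m h + n h) = adj m + adj n.
Proof.
move=> bm bn; apply: dual_ext => x.
rewrite (adjE _ (bounded_functionalD bm bn)) -(adjE x bm) -(adjE x bn).
by [].
Qed.

Lemma adjZ r (a : R) m : bounded_functional r m -> adj (fun h => a * m h) = a *: adj m.
Proof.
move=> bm; apply: dual_ext => x.
rewrite (adjE _ (bounded_functionalZ a bm)) -(adjE x bm).
by [].
Qed.

Let M_ge0 := is_norm_ge0 M_norm.

Lemma H_ub r m j h : bounded_functional r m -> H j h -> m h <= support_fun (H j) m.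
Proof. by move=> bm; exact: (support_fun_ub bm (@H_test j)). Qed.

Lemma H_ge0 r m j : bounded_functional r m -> 0 <= support_fun (H j) m.
Proof.
move=> bm; have [h Hh] := H_nonempty j.
have [ch _ _] := H_test Hh.
by have := H_ub bm Hh; have := H_ub bm (H_sym Hh); rewrite (bfunZ bm)//; lra.
Qed.

Lemma H_le r m j : bounded_functional r m -> support_fun (H j) m <= r.
Proof.
move=> bm; apply: ge_support_fun => // h /H_test th.
by have := test_le bm th.
Qed.

Lemma H_D r s m n j : bounded_functional r m -> bounded_functional s n ->
  support_fun (H j) (fun h => m h + n h) <= support_fun (H j) m + support_fun (H j) n.
Proof.
move=> bm bn; apply: ge_support_fun => // h Hh.
by rewrite lerD// ?(H_ub bm)// (H_ub bn).
Qed.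

Lemma H_Z r (a : R) m j : bounded_functional r m ->
  support_fun (H j) (fun h => a * m h) <= `|a| * support_fun (H j) m.
Proof.
move=> bm; apply: ge_support_fun => // h Hh; have [ch _ _] := H_test Hh.
have [a0|a0] := leP 0 a; first by rewrite ger0_norm// ler_wpM2l// (H_ub bm).
rewrite ltr0_norm// -[a * m h]mulrNN ler_wpM2l ?oppr_ge0 ?(ltW a0)//.
by have := H_ub bm (H_sym Hh); rewrite (bfunZ bm)// mulN1r.
Qed.

Definition energy m : R := wsum (fun j => support_fun (H j) m ^+ 2).

Lemma H_sqr r m j : bounded_functional r m -> 0 <= support_fun (H j) m ^+ 2 <= r ^+ 2.
Proof.
move=> bm; rewrite sqr_ge0/= ler_sqr ?nnegrE ?(H_ge0 _ bm) ?(H_le _ bm)//.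
exact: le_trans (H_ge0 j bm) (H_le j bm).
Qed.

Lemma energy_ge0 r m : bounded_functional r m -> 0 <= energy m.
Proof.
by move=> bm; apply: (@wsum_ge0 _ _ (r ^+ 2)) => j; case/andP: (H_sqr j bm).
Qed.

Lemma energy_le r m : bounded_functional r m -> energy m <= r ^+ 2.
Proof.
move=> bm; apply: wsum_le => k; apply: psum_le; first exact: sqr_ge0.
by move=> j; case/andP: (H_sqr j bm).
Qed.

(** The total variation is the term of index 0, which has weight 1/2. *)
Lemma variation_le_energy r m : bounded_functional r m -> variation m setT ^+ 2 <= 2 * energy m.
Proof.
move=> bm; rewrite -ler_pdivrMl// /variation -H0.
have := @wsum_ge_term _ (fun j => support_fun (H j) m ^+ 2) (r ^+ 2) _ _ 0%N.
by rewrite expn1; apply=> j; case/andP: (H_sqr j bm).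
Qed.

Lemma energyZ r (a : R) m : bounded_functional r m ->
  energy (fun h => a * m h) <= a ^+ 2 * energy m.
Proof.
move=> bm; rewrite -[leRHS]addr0 -(mul0r (energy m)).
apply: (@wsum_comb _ _ _ _ (r ^+ 2)); rewrite ?sqr_ge0// => j; try exact: (H_sqr j bm).
rewrite mul0r addr0 -(real_normK (num_real a)) -exprMn ler_sqr ?nnegrE.
- exact: H_Z bm.
- exact: H_ge0 (bounded_functionalZ a bm).
- by rewrite mulr_ge0// (H_ge0 j bm).
Qed.

Let maxr_sqr (r s : R) : 0 <= r -> 0 <= s -> r ^+ 2 <= (r + s) ^+ 2 /\ s ^+ 2 <= (r + s) ^+ 2.
Proof. by move=> r0 s0; rewrite !ler_sqr ?nnegrE//; lra. Qed.

Lemma H_comb r s m n (t : R) j : 0 < t < 1 ->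
  bounded_functional r m -> bounded_functional s n ->
  support_fun (H j) (fun h => m h + n h) ^+ 2 <=
  t^-1 * support_fun (H j) m ^+ 2 + (1 - t)^-1 * support_fun (H j) n ^+ 2.
Proof.
move=> t01 bm bn; apply: sqr_comb => //; last exact: H_D bm bn.
exact: H_ge0 (bounded_functionalD bm bn).
Qed.

Lemma energyD r s m n (t : R) : 0 < t < 1 ->
  bounded_functional r m -> bounded_functional s n ->
  energy (fun h => m h + n h) <= t^-1 * energy m + (1 - t)^-1 * energy n.
Proof.
move=> t01 bm bn; have /andP[t0 t1] := t01.
have r0 := le_trans (H_ge0 0 bm) (H_le 0 bm).
have s0 := le_trans (H_ge0 0 bn) (H_le 0 bn).
have [r2 s2] := maxr_sqr r0 s0.
apply: (@wsum_comb _ _ _ _ ((r + s) ^+ 2)) => [||j|j|j].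
- by rewrite invr_ge0 ltW.
- by rewrite invr_ge0 subr_ge0 ltW.
- by have /andP[-> a] := H_sqr j bm; exact: le_trans a r2.
- by have /andP[-> a] := H_sqr j bn; exact: le_trans a s2.
- exact: H_comb t01 bm bn.
Qed.

(** By [H_comb] at 1/2 the inequality holds term by term, so equality of the sums passes to every
    term. Then [2 x^2 + 2 y^2 = z^2] with [z <= x + y] gives [x = y] and [z = x + y], as [H_rigid]
    requires. *)
Lemma energy_rigid r s m n : bounded_functional r m -> bounded_functional s n ->
  2 * energy m + 2 * energy n <= energy (fun h => m h + n h) ->
  adj m = adj n.
Proof.
move=> bm bn E.
have r0 := le_trans (H_ge0 0 bm) (H_le 0 bm).
have s0 := le_trans (H_ge0 0 bn) (H_le 0 bn).
have [r2 s2] := maxr_sqr r0 s0.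
pose a j := 2 * support_fun (H j) m ^+ 2 + 2 * support_fun (H j) n ^+ 2.
pose c j := support_fun (H j) (fun h => m h + n h) ^+ 2.
have half : 0 < (2^-1 : R) < 1 by apply/andP; split; lra.
have ca j : 0 <= c j <= a j.
  rewrite sqr_ge0/=; have := H_comb j half bm bn.
  by rewrite invrK (_ : 1 - 2^-1 = 2^-1 :> R) ?invrK//; lra.
have aE : wsum a <= wsum c.
  apply: le_trans E; apply: (@wsum_comb _ _ _ _ ((r + s) ^+ 2)) => [//|//|j|j|j].
  - by have /andP[-> u] := H_sqr j bm; exact: le_trans u r2.
  - by have /andP[-> u] := H_sqr j bn; exact: le_trans u s2.
  - by [].
have aC j : a j <= 4 * (r + s) ^+ 2.
  have /andP[_ u] := H_sqr j bm; have /andP[_ v] := H_sqr j bn; rewrite /a; lra.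
have a0 j : 0 <= a j by case/andP: (ca j) => c0; exact: le_trans c0.
have ac := wsum_strict a0 aC ca aE.
have eqs j : support_fun (H j) m = support_fun (H j) n /\
    support_fun (H j) (fun h => m h + n h) = support_fun (H j) m + support_fun (H j) n.
  have : a j = c j by rewrite ac.
  rewrite /a /c; have := H_D j bm bn; have := H_ge0 j (bounded_functionalD bm bn).
  have := H_ge0 j bm; have := H_ge0 j bn.
  set x := support_fun _ m; set y := support_fun _ n; set z := support_fun _ _.
  move=> y0 x0 z0 zxy e.
  have z2 : z ^+ 2 <= (x + y) ^+ 2 by rewrite ler_sqr ?nnegrE ?addr_ge0.
  have xy2 : (x - y) ^+ 2 <= 0.
    by rewrite (_ : _ ^+ 2 = 2 * x ^+ 2 + 2 * y ^+ 2 - (x + y) ^+ 2); [lra|ring].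
  have xy : x = y.
    apply/eqP; rewrite -subr_eq0 -sqrf_eq0; apply/eqP/le_anti.
    by rewrite xy2 sqr_ge0.
  split=> //; apply/eqP; rewrite eq_le zxy /= -ler_sqr ?nnegrE ?addr_ge0//.
  by rewrite -e xy (_ : (y + y) ^+ 2 = 2 * y ^+ 2 + 2 * y ^+ 2); [|ring].
apply: dual_ext => x; rewrite (adjE x bm) (adjE x bn).
by apply: (H_rigid bm bn) => // j; have [] := eqs j.
Qed.

Definition cost (k : nat) f m : R := M (f - adj m) ^+ 2 + k.+1%:R^-1 * energy m.

Lemma cost_ge0 r k f m : bounded_functional r m -> 0 <= cost k f m.
Proof. by move=> bm; rewrite addr_ge0 ?sqr_ge0// mulr_ge0// (energy_ge0 bm). Qed.

Lemma costD r s k f g m n (t : R) : 0 < t < 1 ->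
  bounded_functional r m -> bounded_functional s n ->
  cost k (f + g) (fun h => m h + n h) <= t^-1 * cost k f m + (1 - t)^-1 * cost k g n.
Proof.
move=> t01 bm bn; rewrite /cost (adjD bm bn).
have -> : f + g - (adj m + adj n) = (f - adj m) + (g - adj n) by rewrite opprD addrACA.
have M2 := sqr_comb t01 (M_ge0 _) (is_normD M_norm (f - adj m) (g - adj n)).
have k0 : 0 <= k.+1%:R^-1 :> R by rewrite invr_ge0.
have E2 := ler_wpM2l k0 (energyD t01 bm bn).
move: M2 E2.
set a := t^-1; set b := (1 - t)^-1; set c := k.+1%:R^-1.
set x := M (f - _) ^+ 2; set y := M (g - _) ^+ 2; set z := M _ ^+ 2.
lra.
Qed.

Lemma costZ r k (a : R) f m : bounded_functional r m ->
  cost k (a *: f) (fun h => a * m h) <= a ^+ 2 * cost k f m.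
Proof.
move=> bm; rewrite /cost (adjZ a bm) -scalerBr (is_normZ M_norm) exprMn.
rewrite real_normK ?num_real// mulrDr lerD2l mulrCA ler_wpM2l//.
exact: energyZ bm.
Qed.

Lemma zero_functional : bounded_functional 0 (fun _ : T -> R => 0 : R).
Proof. by split=> [a g h _ _|g _ _|//]; rewrite ?mulr0 ?addr0 ?normr0. Qed.

Lemma cost0 k f : cost k f (fun=> 0) = M f ^+ 2.
Proof.
have b0 := zero_functional.
rewrite /cost; have -> : energy (fun=> 0) = 0.
  apply: le_anti; rewrite (energy_ge0 b0) andbT.
  by have := energy_le b0; rewrite expr0n.
rewrite mulr0 addr0; congr (M _ ^+ 2).
by apply: dual_ext => x; rewrite (_ : adj _ = 0) ?subr0//; apply: dual_ext => y;
  rewrite (adjE y b0).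
Qed.

(** The penalty is coercive: it bounds the energy by [(k+1) c] and so the square of the total
    variation. The estimate [2 x <= x^2 + 1] avoids a square root. *)
Lemma cost_bounded r k f m c : bounded_functional r m -> cost k f m <= c ->
  bounded_functional (1 + 2 * k.+1%:R * c) m.
Proof.
move=> bm mc; apply: bounded_functionalS (bounded_functional_nrm bm).
have e0 := energy_ge0 bm; have := variation_le_energy bm.
have : energy m <= k.+1%:R * c.
  rewrite -ler_pdivrMl//; apply: le_trans mc; rewrite /cost lerDr; exact: sqr_ge0.
set x := variation m setT; move=> ec xe.
have : 0 <= (x - 1) ^+ 2 by exact: sqr_ge0.
rewrite -mulrA (_ : (x - 1) ^+ 2 = x ^+ 2 - 2 * x + 1); last by ring.
lra.
Qed.

Section closedness.
Context (A : set (weak_star X)) (s : R).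
Hypothesis cA : closed A.
Let B : set (weak_star X * P) := A `*` [set m : P | bounded_functional s m].

Lemma pairs_closed : closed B.
Proof.
rewrite (_ : B = (fst @^-1` A) `&` (snd @^-1` [set m : P | bounded_functional s m])) //.
apply: closedI; apply: preimage_closed => //.
- by move=> x _; exact: cvg_fst.
- by move=> x _; exact: cvg_snd.
- exact: bounded_functional_closed.
Qed.

Lemma cost_sublevel_closed k :
  sublevel_closed B (fun z => cost k z.1 z.2).
Proof.
have cB := pairs_closed.
apply: sublevel_closedD.
  apply: sublevel_closed_sqr => // c.
  (* On [B] this is [f - adj m], but the formula is continuous on all pairs, whereas [adj] is
     meaningful for bounded functionals only. *)
  pose L (z : weak_star X * P) : prod_topology (fun _ : X => R) :=
    fun x => (z.1 : dual X) x - z.2 (ev x).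
  have cL : continuous L.
    apply: continuous_to_prod => x z.
    apply: (@continuousB R R (weak_star X * P)%type (fun z => (z.1 : dual X) x)
      (fun z => z.2 (ev x))).
    - apply: (@continuous_comp _ _ _ fst (fun f : weak_star X => (f : dual X) x)).
        exact: cvg_fst.
      exact: weak_star_eval_continuous.
    - apply: (@continuous_comp _ _ _ snd (fun m : P => m (ev x))).
        exact: cvg_snd.
      exact: eval_prod_continuous.
  have [W oW WE] := (lower_semicontinuousP _).1 M_lsc c.
  have ME f : (c < M f) <-> W (f : X -> R).
    have : [set f : weak_star X | c%:E < (M f)%:E]%E f <-> W (f : X -> R).
      by rewrite -WE.
    by rewrite /= lte_fin.
  rewrite (_ : _ `&` _ = B `&` L @^-1` (~` W)).
    apply: closedI => //; apply: preimage_closed; first by move=> z _; exact: cL.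
    exact: open_closedC.
  have LE z : B z -> L z = ((z.1 : dual X) - adj z.2 : dual X) :> (X -> R).
    by move=> [_ bz]; apply/funext => x; rewrite /L -(adjE x bz).
  apply/seteqP; split=> z [Bz] /= Mz; split=> //.
    by rewrite LE// => /ME; rewrite ltNge Mz.
  by rewrite leNgt; apply/negP => /ME; rewrite -LE.
apply: sublevel_closedZ => //.
apply: (@sublevel_closed_wsum _ _ _ cB _ (s ^+ 2)).
  by move=> z j [_ bz]; exact: H_sqr bz.
move=> j; apply: sublevel_closed_sqr => //.
  by move=> z [_ bz]; exact: H_ge0 bz.
move=> c; rewrite (_ : _ `&` _ = B `&` \bigcap_(h in H j) [set z | z.2 h <= c]).
  apply: closedI => //; apply: closed_bigI => h _.
  apply: (@preimage_closed _ _ (fun z : weak_star X * P => z.2 h) [set y : R | y <= c]);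
    last exact: closed_le.
  move=> z _; apply: (@continuous_comp _ _ _ snd (fun m : P => m h)).
    exact: cvg_snd.
  exact: eval_prod_continuous.
apply/seteqP; split=> z [Bz] /= zc; split=> //.
  by move=> h Hh /=; apply: le_trans zc; case: Bz => _ bz; exact: H_ub bz Hh.
by apply: ge_support_fun => // h Hh; exact: zc.
Qed.

End closedness.

(** Functionals costing more than the zero functional, whose cost is [M f ^+ 2], can be discarded;
    by [cost_bounded] the others lie in a fixed compact ball. *)
Lemma cost_min k f : exists m, (exists r, bounded_functional r m) /\
  forall r n, bounded_functional r n -> cost k f m <= cost k f n.
Proof.
pose s := 1 + 2 * k.+1%:R * M f ^+ 2.
have s0 : 0 <= s by rewrite addr_ge0// !mulr_ge0// sqr_ge0.
have c1 : closed [set (f : weak_star X)].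
  by apply: (compact_closed weak_star_hausdorff); exact: compact_set1.
have kB : compact ([set (f : weak_star X)] `*` [set m : P | bounded_functional s m]).
  apply: compact_setX; first exact: compact_set1.
  exact: bounded_functional_compact.
have B0 : ([set (f : weak_star X)] `*` [set m : P | bounded_functional s m])
    (f, (fun=> 0)).
  by split=> //=; exact: bounded_functionalS s0 zero_functional.
have [[g m] [/= -> bm] mmin] := sublevel_closed_min kB B0 (@cost_sublevel_closed _ s c1 k).
exists m; split; first by exists s.
move=> r n bn; have [le|lt] := leP (cost k f n) (M f ^+ 2).
  by apply: (mmin (f, n)); split=> //=; exact: cost_bounded bn le.
by apply: le_trans (mmin _ B0) _ => /=; rewrite cost0 ltW.
Qed.

Definition optimal k f : (T -> R) -> R := projT1 (cid (cost_min k f)).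

Lemma optimal_bounded k f : exists r, bounded_functional r (optimal k f).
Proof. by rewrite /optimal; case: cid => m /= []. Qed.

Definition min_cost k f : R := cost k f (optimal k f).

Lemma min_cost_le r k f n : bounded_functional r n -> min_cost k f <= cost k f n.
Proof. by rewrite /min_cost /optimal; case: cid => m /= [_]; exact. Qed.

Lemma min_cost_ge0 k f : 0 <= min_cost k f.
Proof. by have [r bm] := optimal_bounded k f; exact: cost_ge0 bm. Qed.

Lemma min_cost_le_norm k f : min_cost k f <= CM ^+ 2 * `|f| ^+ 2.
Proof.
apply: le_trans (min_cost_le k f zero_functional) _; rewrite cost0 -exprMn.
rewrite ler_sqr ?nnegrE ?M_ge0//.
by apply: le_trans (M_ge0 f) (M_le f).
Qed.

Lemma min_costD k f g (t : R) : 0 < t < 1 ->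
  min_cost k (f + g) <= t^-1 * min_cost k f + (1 - t)^-1 * min_cost k g.
Proof.
move=> t01; have [r bm] := optimal_bounded k f; have [s bn] := optimal_bounded k g.
apply: le_trans (min_cost_le k _ (bounded_functionalD bm bn)) _.
exact: costD t01 bm bn.
Qed.

Lemma min_costZ k (a : R) f : min_cost k (a *: f) <= a ^+ 2 * min_cost k f.
Proof.
have [r bm] := optimal_bounded k f.
apply: le_trans (min_cost_le k _ (bounded_functionalZ a bm)) _.
exact: costZ bm.
Qed.

(** As the infimum is attained, the sublevel set is the projection of a sublevel set of [cost] in a
    compact product. *)
Lemma min_cost_sublevel_closed k (r : R) : 0 <= r ->
  sublevel_closed [set f : weak_star X | `|(f : dual X)| <= r]
    (fun f : weak_star X => min_cost k (f : dual X)).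
Proof.
move=> r0 c; apply: (compact_closed weak_star_hausdorff).
pose A := [set f : weak_star X | `|(f : dual X)| <= r].
have kA : compact A := alaoglu r0.
have cA : closed A by apply: (compact_closed weak_star_hausdorff).
pose s := 1 + 2 * k.+1%:R * c.
pose B := A `*` [set m : P | bounded_functional s m].
have kB : compact B.
  by apply: compact_setX => //; exact: bounded_functional_compact.
rewrite (_ : _ `&` _ = fst @` (B `&` [set z | cost k z.1 z.2 <= c])).
  apply: continuous_compact.
    by apply: continuous_subspaceT => z; exact: cvg_fst.
  apply: subclosed_compact kB _; last by move=> z [].
  exact: cost_sublevel_closed.
apply/seteqP; split=> [f [/= fr fc]|_ [[f m] [[/= fr bm] mc] <-]].
  have [r' bm] := optimal_bounded k f.
  exists (f, optimal k f) => //; split=> //; split=> //=.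
  exact: cost_bounded bm fc.
by split=> //=; exact: le_trans (min_cost_le k f bm) mc.
Qed.

(** The sum of the two minimisers competes for [f + g]. Both parts of its cost obey the convexity
    inequality, so equality of the totals passes to the energies. *)
Lemma min_cost_rigid k f g :
  2 * min_cost k f + 2 * min_cost k g <= min_cost k (f + g) ->
  adj (optimal k f) = adj (optimal k g).
Proof.
move=> E; have [r bm] := optimal_bounded k f; have [s bn] := optimal_bounded k g.
apply: (energy_rigid bm bn); move: E.
have half : 0 < (2^-1 : R) < 1 by apply/andP; split; lra.
have two : 1 - 2^-1 = 2^-1 :> R by lra.
have := min_cost_le k (f + g) (bounded_functionalD bm bn).
rewrite /min_cost /cost (adjD bm bn).
have -> : f + g - (adj (optimal k f) + adj (optimal k g)) =
  (f - adj (optimal k f)) + (g - adj (optimal k g)) by rewrite opprD addrACA.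
have := sqr_comb half (M_ge0 _)
  (is_normD M_norm (f - adj (optimal k f)) (g - adj (optimal k g))).
rewrite two !invrK => h1 h2 h3.
rewrite -(ler_pM2l (_ : 0 < k.+1%:R^-1)) ?invr_gt0//.
move: h1 h2 h3; set x := M (f - _) ^+ 2; set y := M (g - _) ^+ 2.
set c := _^-1; lra.
Qed.

Hypothesis dense : forall f (e : R), 0 < e ->
  exists m, (exists r, bounded_functional r m) /\ M (f - adj m) < e.

(** One good approximant [m] serves for all [k], and its penalty tends to 0. The choice of [d]
    ensures [d^2 <= d <= e / 2]. *)
Lemma min_cost_small f (e : R) : 0 < e -> exists K, forall k, (K <= k)%N -> min_cost k f <= e.
Proof.
move=> e0; pose d := Num.min 1 (e / 2); have d0 : 0 < d by rewrite lt_min; apply/andP; split; lra.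
have [m [[r bm] md]] := dense f d0.
have en := energy_ge0 bm.
exists (Num.truncn (2 * energy m / e)) => k Kk.
apply: le_trans (min_cost_le k f bm) _; rewrite /cost.
have : M (f - adj m) ^+ 2 <= e / 2.
  have d1 : d <= 1 by rewrite ge_min lexx.
  have d2 : d <= e / 2 by rewrite ge_min lexx orbT.
  apply: (@le_trans _ _ (d * 1)); last by rewrite mulr1.
  by rewrite expr2 ler_pM ?M_ge0 ?(ltW md)// (le_trans (ltW md)).
have : k.+1%:R^-1 * energy m <= e / 2.
  rewrite ler_pdivrMl//.
  have : 2 * energy m / e <= k.+1%:R.
    by apply/ltW/(lt_le_trans (truncnS_gt _)); rewrite ler_nat.
  by rewrite ler_pdivrMr//; lra.
set c := _^-1; lra.
Qed.

Definition renorm_sqr f : R := `|f| ^+ 2 + wsum (fun k => min_cost k f).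

Let bound f k : 0 <= min_cost k f <= CM ^+ 2 * `|f| ^+ 2.
Proof. by rewrite min_cost_ge0 min_cost_le_norm. Qed.

Let wsum_min_cost_ge0 f : 0 <= wsum (fun k => min_cost k f).
Proof.
by apply: (@wsum_ge0 _ _ (CM ^+ 2 * `|f| ^+ 2)) => k; case/andP: (bound f k).
Qed.

Lemma renorm_sqr_ge f : `|f| ^+ 2 <= renorm_sqr f.
Proof. by rewrite lerDl. Qed.

Lemma renorm_sqr_le f : renorm_sqr f <= (1 + CM ^+ 2) * `|f| ^+ 2.
Proof.
rewrite mulrDl mul1r lerD2l; apply: wsum_le => n; apply: psum_le.
  by rewrite mulr_ge0// sqr_ge0.
by move=> k; case/andP: (bound f k).
Qed.

Let bound2 f g : let C := CM ^+ 2 * `|f| ^+ 2 + CM ^+ 2 * `|g| ^+ 2 in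
  (forall k, 0 <= min_cost k f <= C) /\ (forall k, 0 <= min_cost k g <= C).
Proof.
have u h : 0 <= CM ^+ 2 * `|h : dual X| ^+ 2 by rewrite mulr_ge0 ?sqr_ge0.
move=> C; split=> k; [have /andP[-> a] := bound f k|have /andP[-> a] := bound g k].
  by apply: le_trans a _; rewrite lerDl.
by apply: le_trans a _; rewrite lerDr.
Qed.

Lemma renorm_sqrD f g (t : R) : 0 < t < 1 ->
  renorm_sqr (f + g) <= t^-1 * renorm_sqr f + (1 - t)^-1 * renorm_sqr g.
Proof.
move=> t01; have /andP[t0 t1] := t01; rewrite /renorm_sqr.
have [b1 b2] := bound2 f g.
have := sqr_comb t01 (normr_ge0 _) (ler_normD f g).
have ti : 0 <= t^-1 by rewrite invr_ge0 ltW.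
have ti' : 0 <= (1 - t)^-1 by rewrite invr_ge0 subr_ge0 ltW.
have : wsum (fun k => min_cost k (f + g)) <=
    t^-1 * wsum (fun k => min_cost k f) + (1 - t)^-1 * wsum (fun k => min_cost k g).
  by apply: (wsum_comb ti ti' b1 b2) => k; exact: min_costD.
move: (wsum _) (wsum _) (wsum _) => x y z.
move: (`|f + g| ^+ 2) (`|f| ^+ 2) (`|g| ^+ 2) (t^-1) ((1 - t)^-1) => x' y' z' a b.
lra.
Qed.

Lemma renorm_sqrZ (a : R) f : renorm_sqr (a *: f) = a ^+ 2 * renorm_sqr f.
Proof.
have Zle (b : R) h : renorm_sqr (b *: h) <= b ^+ 2 * renorm_sqr h.
  rewrite /renorm_sqr mulrDr normrZ exprMn real_normK ?num_real// lerD2l.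
  rewrite -[leRHS]addr0 -(mul0r (wsum (fun k => min_cost k h))).
  apply: (@wsum_comb _ _ _ _ (CM ^+ 2 * `|h| ^+ 2)) => //; first exact: sqr_ge0.
  by move=> k; rewrite mul0r addr0; exact: min_costZ.
apply/eqP; rewrite eq_le Zle/=; have [->|a0] := eqVneq a 0.
  by rewrite expr0n mul0r; apply: le_trans (renorm_sqr_ge _); exact: sqr_ge0.
have a2 : 0 < a ^+ 2 by rewrite exprn_even_gt0.
rewrite -ler_pdivlMl//; have := Zle a^-1 (a *: f).
by rewrite scalerA mulVf// scale1r exprVn.
Qed.

(** The term [|f|^2] confines this set to the unit ball [A], where all [min_cost k] are bounded by
    [CM^2] and lower semicontinuous. *)
Lemma renorm_sqr_closed_ball : closed [set f : weak_star X | renorm_sqr (f : dual X) <= 1].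
Proof.
pose A := [set f : weak_star X | `|(f : dual X)| <= 1].
have cA : closed A.
  by apply: (compact_closed weak_star_hausdorff); exact: alaoglu ler01.
have : sublevel_closed A (fun f : weak_star X => renorm_sqr (f : dual X)).
  apply: sublevel_closedD => //.
    apply: sublevel_closed_sqr => // c.
    apply: (compact_closed weak_star_hausdorff).
    have [c0|c0] := leP 0 c.
      refine (@subclosed_compact (weak_star X) _ _ _ (alaoglu c0) _); last by move=> f [].
      by apply: closedI => //; apply: (compact_closed weak_star_hausdorff); exact: alaoglu c0.
    rewrite (_ : _ `&` _ = set0); first exact: compact0.
    by apply/seteqP; split=> // f [_ /= fc]; have := le_lt_trans fc c0; rewrite normr_lt0.
  apply: (@sublevel_closed_wsum _ _ _ cA _ (CM ^+ 2)).
    move=> f k; rewrite /A /= => f1; have /andP[-> b] := bound f k.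
    apply: le_trans b _; rewrite ler_piMr ?sqr_ge0//.
    by rewrite -(expr1n _ 2) ler_sqr ?nnegrE.
  by move=> k; exact: min_cost_sublevel_closed ler01.
move=> /(_ 1); congr closed; apply/seteqP; split=> f /= => [[]//|f1]; split=> //.
rewrite /A /= -ler_sqr ?nnegrE// expr1n; exact: le_trans (renorm_sqr_ge f) f1.
Qed.

Definition renorm : dual X -> R := sqrt_norm renorm_sqr.

Lemma renorm_equivalent_dual_norm : equivalent_dual_norm renorm.
Proof.
apply: sqrt_norm_equivalent_dual_norm.
- exact: renorm_sqrD.
- exact: renorm_sqrZ.
- exact: renorm_sqr_ge.
- exact: renorm_sqr_le.
- exact: renorm_sqr_closed_ball.
Qed.

Lemma renorm_strictly_convex : strictly_convex renorm.
Proof.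
have half : 0 < (2^-1 : R) < 1 by apply/andP; split; lra.
have two : 1 - 2^-1 = 2^-1 :> R by lra.
have four (u v c : R) : 0 <= u <= c -> 0 <= v <= c -> 2 * u + 2 * v <= 4 * c by lra.
have split_e (x y z e : R) : z <= x + y -> x <= e / 2 -> y <= e / 2 -> z <= e by lra.
move=> f g fg gfg; have E : renorm_sqr (f + g) = 2 * renorm_sqr f + 2 * renorm_sqr g.
  exact: (sqrt_norm_midpoint renorm_sqr_ge fg gfg).
move=> {fg gfg}.
have [b1 b2] := bound2 f g.
pose a k := 2 * min_cost k f + 2 * min_cost k g.
have ca k : 0 <= min_cost k (f + g) <= a k.
  by rewrite min_cost_ge0 /=; have := min_costD k f g half; rewrite two !invrK.
have aw : wsum a <= 2 * wsum (fun k => min_cost k f) + 2 * wsum (fun k => min_cost k g).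
  exact: wsum_comb b1 b2 _.
have := sqr_comb half (normr_ge0 _) (ler_normD f g).
rewrite two !invrK => n2.
have ac : wsum a <= wsum (fun k => min_cost k (f + g)).
  move: E aw n2; rewrite /renorm_sqr; move: (wsum _) (wsum _) (wsum _) (wsum _) => x y z w.
  by lra.
set C := CM ^+ 2 * `|f| ^+ 2 + CM ^+ 2 * `|g| ^+ 2 in b1 b2.
have a0 k : 0 <= a k by case/andP: (ca k) => c0; exact: le_trans c0.
have aC k : a k <= 4 * C.
  exact: four (b1 k) (b2 k).
have {}ac := wsum_strict a0 aC ca ac.
have adj_eq k : adj (optimal k f) = adj (optimal k g).
  by apply: min_cost_rigid; rewrite -/(a k) ac.
have Msqr k h : M (h - adj (optimal k h)) ^+ 2 <= min_cost k h.
  have [r bm] := optimal_bounded k h.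
  by rewrite lerDl mulr_ge0// (energy_ge0 bm).
(* For large [k] the common image of the minimisers is within [e / 2] of both [f] and [g] for
   [M]. *)
have MB : M (f - g) = 0.
  apply: le_anti; rewrite M_ge0 andbT; apply/ler_addgt0Pr => e e0; rewrite add0r.
  have e2 : 0 < (e / 2) ^+ 2 by rewrite exprn_gt0// divr_gt0.
  have [K1 fK] := min_cost_small f e2; have [K2 gK] := min_cost_small g e2.
  pose k := maxn K1 K2.
  have fk := le_trans (Msqr k f) (fK k (leq_maxl _ _)).
  have gk := le_trans (Msqr k g) (gK k (leq_maxr _ _)).
  have e20 : 0 <= e / 2 by rewrite divr_ge0// ltW.
  rewrite ler_sqr ?nnegrE ?M_ge0// in fk.
  rewrite ler_sqr ?nnegrE ?M_ge0// in gk.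
  have -> : f - g = (f - adj (optimal k f)) + - (g - adj (optimal k g)).
    by rewrite adj_eq opprB addrA subrK.
  apply: split_e (is_normD M_norm _ _) fk _.
  by rewrite (is_normN M_norm).
by apply/eqP; rewrite -subr_eq0; apply/eqP; exact: is_norm0_eq0 M_norm _ MB.
Qed.

End renorming.


(** * Application to the Gruenhage compact *)

Lemma test_opp (R : realType) (T : topologicalType) (U : set T)
    (h : T -> R) : test U h -> test U (fun t => -1 * h t).
Proof.
move=> [ch h1 h0]; split=> [|t|t /h0 ->].
- by apply: continuous_mul => //; exact: cst_continuousR.
- by rewrite mulN1r normrN.
- by rewrite mulr0.
Qed.

Lemma hull_tests_opp (R : realType) (T : topologicalType) (D : set (set T)) S k
    (h : T -> R) : hull_tests D S k h -> hull_tests D S k (fun t => -1 * h t).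
Proof. by move=> [F [Fk FD /test_opp th]]; exists F. Qed.

Section weak_star_compact.
Context {R : realType} {X : completeNormedModType R} (K : set (weak_star X)).

Definition evaluation (x : X) (t : set_type K) : R := (set_val t : dual X) x.

Lemma evaluation_continuous x : continuous (evaluation x).
Proof.
move=> t; apply: (@continuous_comp _ _ _ (set_val : set_type K -> weak_star X)
  (fun f : weak_star X => (f : dual X) x)).
  exact: initial_continuous.
exact: weak_star_eval_continuous.
Qed.

Lemma evaluation_linear (a : R) x y t :
  evaluation (a *: x + y) t = a * evaluation x t + evaluation y t.
Proof. by rewrite /evaluation linearP. Qed.

(** Compactness bounds each [evaluation x] on [K]; completeness of [X] makes the bound uniform by
    Banach-Steinhaus. *)
Lemma evaluation_bounded : compact [set: set_type K] ->
  exists2 C, 0 <= C & forall x t, `|evaluation x t| <= C * `|x|.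
Proof.
move=> cT.
pose F := [set f : X -> R^o | exists t : set_type K, f = (set_val t : dual X)].
have FP f : F f -> bounded_fun_norm f /\ linear f.
  move=> [t ->]; split; last exact: dual_linear.
  move=> r; exists (`|(set_val t : dual X)| * `|r|) => x xr.
  apply: le_trans (dual_le_norm _ _) _; rewrite ler_wpM2l//.
  exact: le_trans xr (ler_norm r).
have [|C CP] := Banach_Steinhauss FP _ 1.
  move=> x; have [c _ xc] := compact_bounded_fun cT (@evaluation_continuous x).
  by exists c => _ [t ->]; exact: xc.
exists `|C| => // x t.
have tC : `|(set_val t : dual X)| <= `|C|.
  apply: dual_norm_le => y y1; apply: le_trans (ler_norm C).
  by apply: CP => //; exists t.
by apply: le_trans (dual_le_norm _ _) _; rewrite ler_wpM2r.
Qed.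

(** A combination of points of [K] is the image of the same combination of point masses, set to 0 at
    discontinuous functions as [bfun_junk] requires. *)
Lemma linear_span_adj (y : dual X) :
  compact [set: set_type K] -> linear_span (K : set (dual X)) y ->
  exists m, (exists r, bounded_functional r m) /\ adj evaluation m = y.
Proof.
move=> cT [n [a [v [Kv ->]]]].
pose p i : set_type K := SigSub (mem_set (Kv i)).
pose m (g : set_type K -> R) : R :=
  if pselect (continuous g) then \sum_(i < n) a i * g (p i) else 0.
have mE g : continuous g -> m g = \sum_(i < n) a i * g (p i).
  by rewrite /m; case: pselect.
have bm : bounded_functional (\sum_(i < n) `|a i|) m.
  split=> [c g h cg ch|g cg g1|g ncg].
  - rewrite !mE//; last exact: continuous_affine.
    by rewrite mulr_sumr -big_split /=; apply: eq_bigr => i _; ring.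
  - rewrite mE//; apply: le_trans (ler_norm_sum _ _ _) _.
    by apply: ler_sum => i _; rewrite normrM ler_piMr.
  - by rewrite /m; case: pselect.
have [C C0 evC] := evaluation_bounded cT.
exists m; split; first by exists (\sum_(i < n) `|a i|).
apply: dual_ext => x.
rewrite (adjE evaluation_continuous evaluation_linear C0 evC x bm) mE; last first.
  exact: evaluation_continuous.
elim/big_rec2: _ => [//|i z f _ ->].
by [].
Qed.

End weak_star_compact.

Unset Implicit Arguments.
Set Strict Implicit.
Set Printing Implicit Defensive.

Theorem corollary2p9 (R : realType) (X : completeNormedModType R)
    (K : set (weak_star X)) (N : dual X -> R)
    (K_gruenhage : gruenhage_compact (set_type K))
    (N_norm : is_norm N)
    (N_equiv : exists M : dual X -> R,
        [/\ is_norm M, norm_coarser M (fun f : dual X => `|f|),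
            weak_star_lsc M & norm_equivalent N M])
    (K_span : norm_closure N (linear_span (K : set (dual X))) = [set: dual X]) :
  exists q : dual X -> R, equivalent_dual_norm q /\ strictly_convex q.
Proof.
have [cT hT gT] := K_gruenhage.
have [M [M_norm [CM M_le] M_lsc [_ [CN MN]]]] := N_equiv.
have [A_ [S_ [oA oS dA sepA]]] := gruenhage_delta gT.
have [C C0 evC] := evaluation_bounded cT.
(* Index 0 is the total variation; the successors enumerate a list of base systems together with a
   number of members, and those that code nothing repeat the total variation. *)
pose H (j : nat) : set (set_type K -> R) :=
  if j is j'.+1 then
    if @unpickle (seq nat * nat)%type j' is Some (J, k) then
      hull_tests (meet_family A_ J) (join_open S_ J) k else test setT
  else test setT.
have H_test j : H j `<=` test setT.
  case: j => [//|j] /=; case: unpickle => [[J k]|//]; exact: hull_tests_test.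
have H_ne j : H j !=set0.
  case: j => [|j] /=; first by exists (fun=> 0); exact: test0.
  case: unpickle => [[J k]|]; first exact: hull_tests_nonempty.
  by exists (fun=> 0); exact: test0.
have H_sym j h : H j h -> H j (fun t => -1 * h t).
  case: j => [|j] /=; first exact: test_opp.
  case: unpickle => [[J k]|]; [exact: hull_tests_opp|exact: test_opp].
have H_rigid r s m n : bounded_functional r m -> bounded_functional s n ->
    (forall j, support_fun (H j) m = support_fun (H j) n) ->
    (forall j, support_fun (H j) (fun h => m h + n h) =
      support_fun (H j) m + support_fun (H j) n) ->
    forall h, continuous h -> m h = n h.
  move=> bm bn e1 e2; apply: (delta_functional_eq cT hT oA oS dA sepA bm bn).
  - exact: (e2 0%N).
  - by move=> J k; have := e1 (pickle (J, k)).+1; rewrite /H pickleK.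
  - by move=> J k; have := e2 (pickle (J, k)).+1; rewrite /H pickleK.
have dense f (e : R) : 0 < e -> exists m,
    (exists r, bounded_functional r m) /\ M (f - adj (@evaluation R X K) m) < e.
  (* The added 1 keeps the divisor positive whatever the constant [CN] is. *)
  move=> e0; have CN1 : 0 < `|CN| + 1 by rewrite ltr_wpDl.
  have : norm_closure N (linear_span (K : set (dual X))) f by rewrite K_span.
  move=> /(_ (e / (`|CN| + 1)))[|y Ky]; first by rewrite divr_gt0.
  rewrite ltr_pdivlMr// => fy.
  have [m [bm my]] := linear_span_adj cT Ky; exists m; split=> //; rewrite my.
  apply: le_lt_trans fy; apply: le_trans (MN _) _; rewrite mulrC.
  rewrite ler_wpM2l// ?(is_norm_ge0 N_norm)//; have := ler_norm CN; lra.
exists (renorm cT (@evaluation_continuous R X K) (@evaluation_linear R X K) C0 evC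
  (erefl : H 0%N = test setT) H_test H_ne H_sym M_norm M_lsc).
split.
  exact: (renorm_equivalent_dual_norm _ _ _ _ _ _ _ _ _ _ M_le).
refine (@renorm_strictly_convex R X (set_type K) cT _ C _ _ C0 evC H _ _ _ _ H_rigid M CM _ M_le _ dense).
Qed.
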